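(* Let $M$ be a loopless oriented matroid of rank $d$ on a finite ground set $E$, with underlying matroid $\underline M$. The integral dual Varchenko--Gelfand filtration produces a filtration of the $\mathbb Z$-sign cosheaf $\mathcal S$ on the matroid fan $\Sigma_{\underline M}$ by cosheaves $$\mathfrak P_d\subset\dots\subset\mathfrak P_{p+1}\subset\mathfrak P_p\subset\dots\subset\mathfrak P_1\subset\mathcal S,$$ where $\mathfrak P_p(\sigma_{\mathcal F})=\mathcal P_p(M_{\mathcal F})$ with cosheaf maps the inclusions. Moreover, for every $p$ there is a short exact sequence of cosheaves $$0\to\mathfrak P_{p+1}\to\mathfrak P_p\to\mathfrak A_p\to0,$$ where $\mathfrak A_p$ is the $p$-th Cordovil cosheaf, $\mathfrak A_p(\sigma_{\mathcal F})=\mathcal A_p(M_{\mathcal F};\mathbb Z)$ with cosheaf maps the inclusions.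
   Context: **Oriented matroids.** $M$ has covector set $\mathcal L\subseteq\{0,+,-\}^E$; its topes are the covectors maximal for the coordinatewise order with $0<+$, $0<-$; as $M$ is loopless, $\mathcal T(M)\subseteq\{+,-\}^E$. Flats of $M$ are the sets $E\setminus\mathrm{supp}(L)$, $L\in\mathcal L$, i.e. the flats of $\underline M$. For a flag of flats $\mathcal F:\emptyset=F_0\subsetneq F_1\subsetneq\dots\subsetneq F_t=E$ (not necessarily complete) the initial oriented matroid is $M_{\mathcal F}=\bigoplus_{i=0}^{t-1}M|_{F_{i+1}}/F_i$, again loopless on $E$. Its tope set is $\mathcal T(M_{\mathcal F})=\mathcal T_{\mathcal F}=\{T\in\mathcal T(M):T\setminus F_i\in\mathcal L\ \forall i\}$, where $T\setminus F$ is $T$ with the coordinates in $F$ set to $0$; so $\mathbb Z[\mathcal T(M_{\mathcal F})]\subseteq\mathbb Z[\mathcal T(M_{\mathcal F'})]$ for $\mathcal F'\subseteq\mathcal F$. **Dual Varchenko--Gelfand filtration.** For a loopless oriented matroid $N$ on $E$ with topes $\mathcal T$, $\mathbb Z[\mathcal T]^*$ is the ring of linear functions $\mathbb Z[\mathcal T]\to\mathbb Z$ with multiplication pointwise on topes. For $e\in E$, $h_e(T)=1$ if $T_e=+$ and $0$ if $T_e=-$. $\mathcal P^p(N)$ is the set of functions representable by a polynomial of degree at most $p$ in the $h_e$ (with $\mathcal P^{-1}(N)=0$), and $\mathcal P_p(N)=\{\gamma\in\mathbb Z[\mathcal T]:f(\gamma)=0\ \forall f\in\mathcal P^{p-1}(N)\}$.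 **Cordovil algebra.** $\mathcal A^\bullet(N;\mathbb Z)$ is the graded quotient of $\mathbb Z[x_i^*:i\in E]$ by the ideal generated by all $(x_i^* )^2$ and all $\sum_{k=1}^tC(i_k)\,x^*_{i_1}\cdots\widehat{x^*_{i_k}}\cdots x^*_{i_t}$, for circuits $\{i_1,\dots,i_t\}$ of $\underline N$ and $C$ a signed circuit of $N$ supported on it. Let $\mathrm{SFSym}(E)=\mathbb Z[x_i:i\in E]/\langle x_i^2\rangle$, paired with $\mathbb Z[x_i^*]/\langle(x_i^* )^2\rangle$ by $\langle(x^* )^S,x^T\rangle=\delta_{S,T}$ on square-free monomials ($x^S=\prod_{i\in S}x_i$). $\mathcal A_p(N;\mathbb Z)\subseteq\mathrm{SFSym}(E)$ is the dual of $\mathcal A^p(N;\mathbb Z)$: the degree $p$ elements annihilated by the degree $p$ part of the ideal defining $\mathcal A^\bullet(N;\mathbb Z)$. **Cosheaves on the matroid fan.** $\Sigma_{\underline M}$ is the polyhedral fan in $\mathbb R^E$ whose cones are $\sigma_{\mathcal F}=\langle\mathbf e_{F_1},\dots,\mathbf e_{F_k},\pm\mathbf e_E\rangle_{\ge0}$, for all flags of flats $\mathcal F:\emptyset\subsetneq F_1\subsetneq\dots\subsetneq F_k\subsetneq E$, where $\mathbf e_F=\sum_{i\in F}\mathbf e_i$. In forming $M_{\mathcal F}$ the flag is understood to include $\emptyset$ and $E$. One has $\sigma_{\mathcal F'}\subseteq\sigma_{\mathcal F}$ iff $\mathcal F'\subseteq\mathcal F$. Viewing the fan as a category with an arrow $\tau\to\sigma$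 whenever $\tau\subseteq\sigma$, a cosheaf is a functor $\Sigma_{\underline M}^{\mathrm{op}}\to\mathrm{Mod}_{\mathbb Z}$, so it has maps from the stalk at $\sigma_{\mathcal F}$ to the stalk at $\sigma_{\mathcal F'}$ for $\mathcal F'\subseteq\mathcal F$. Morphisms of cosheaves are natural transformations; inclusions and exactness are stalkwise. The $\mathbb Z$-sign cosheaf is $\mathcal S(\sigma_{\mathcal F})=\mathbb Z[\mathcal T(M_{\mathcal F})]$ with inclusion maps. The cosheaf maps of $\mathfrak P_p$ are inclusions inside $\mathbb Z[\mathcal T(M)]$ and those of $\mathfrak A_p$ are inclusions inside $\mathrm{SFSym}(E)$. *)

(* Defs.v *)
From HB Require Import structures.
From mathcomp Require Import all_boot all_order all_algebra.
From mathcomp Require Import boolp reals.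
From mathcomp Require Import mpoly.

Set Implicit Arguments.
Unset Strict Implicit.
Unset Printing Implicit Defensive.

Import Order.TTheory GRing.Theory Num.Theory.
Local Open Scope ring_scope.

Inductive sign := Zero | Plus | Minus.

Definition option_of_sign s :=
  match s with Zero => None | Plus => Some true | Minus => Some false end.
Definition sign_of_option o :=
  match o with None => Zero | Some true => Plus | Some false => Minus end.
Lemma option_of_signK : cancel option_of_sign sign_of_option.
Proof. by case. Qed.
HB.instance Definition _ := Finite.copy sign (can_type option_of_signK).

Definition sopp s := match s with Zero => Zero | Plus => Minus | Minus => Plus end.
Definition sint s : int := match s with Zero => 0 | Plus => 1 | Minus => -1 end.

Notation signvec E := {ffun E -> sign}.

Section SignVectors.
Variable E : finType.
Implicit Types (X Y : signvec E) (A : {set E}).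

Definition sv0 : signvec E := [ffun=> Zero].
Definition svopp X : signvec E := [ffun e => sopp (X e)].
Definition svcomp X Y : signvec E := [ffun e => if X e == Zero then Y e else X e].
Definition supp X : {set E} := [set e | X e != Zero].
Definition sep X Y : {set E} := [set e | (X e != Zero) && (Y e == sopp (X e))].
Definition svle X Y : bool := [forall e, (X e == Zero) || (X e == Y e)].
Definition svrestr X A : signvec E := [ffun e => if e \in A then X e else Zero].

Definition orthogonal X Y : bool :=
  [forall e, sint (X e) * sint (Y e) == 0] ||
  [exists e, exists f, (sint (X e) * sint (Y e) == 1)
                    && (sint (X f) * sint (Y f) == -1)].

End SignVectors.
Arguments sv0 {E}.

Record covector_axioms (E : finType) (L : {set signvec E}) : Prop := {
  cov0 : sv0 \in L;
  covN : forall X, X \in L -> svopp X \in L;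
  covC : forall X Y, X \in L -> Y \in L -> svcomp X Y \in L;
  covE : forall X Y e, X \in L -> Y \in L -> e \in sep X Y ->
    exists Z, [/\ Z \in L, Z e = Zero &
                  forall f, f \notin sep X Y -> Z f = svcomp X Y f]
}.

Record oriented_matroid (E : finType) := OrientedMatroid {
  covectors :> {set signvec E};
  covectorsP : covector_axioms covectors
}.

Section OrientedMatroids.
Variable E : finType.
Implicit Types (N : oriented_matroid E) (X Y T C : signvec E).

Definition loopless N : Prop := forall e : E, exists2 X, X \in covectors N & X e <> Zero.

Definition topes N : {set signvec E} :=
  [set T in covectors N | [forall X in covectors N, svle T X ==> (X == T)]].

Definition flats N : {set {set E}} := [set ~: supp X | X in covectors N].

(* The vectors of N are the sign vectors orthogonal to all its covectors; the
   signed circuits are the nonzero vectors of minimal support, and their supports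
   are the circuits of the underlying matroid. *)
Definition vectors N : {set signvec E} :=
  [set X : signvec E | [forall Y in covectors N, orthogonal X Y]].

Definition signed_circuits N : {set signvec E} :=
  [set C in vectors N | (C != sv0) &&
    [forall X in vectors N,
       ((X != sv0) && (supp X \subset supp C)) ==> (supp X == supp C)]].

Definition independent N (I : {set E}) : bool :=
  [forall C in signed_circuits N, ~~ (supp C \subset I)].

Definition omrank N : nat := \max_(I : {set E} | independent N I) #|I|.

End OrientedMatroids.

(* An oriented matroid on a subset of E is encoded by its covectors, extended by
   Zero to all of E. *)
Section Minors.
Variable E : finType.
Implicit Types (L : {set signvec E}) (A : {set E}) (X Y : signvec E).

Definition restriction L A : {set signvec E} := [set svrestr X A | X in L].

Definition contraction L A : {set signvec E} := [set X in L | svrestr X A == sv0].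

Definition direct_sum k (A : 'I_k -> {set E}) (L : 'I_k -> {set signvec E})
  : {set signvec E} :=
  [set X : signvec E | (supp X \subset \bigcup_i A i)
                       && [forall i, svrestr X (A i) \in L i]].

Lemma restriction_axioms L A :
  covector_axioms L -> covector_axioms (restriction L A).
Proof.
case=> L0 LN LC LE; split.
- by apply/imsetP; exists sv0 => //; apply/ffunP=> e; rewrite !ffunE; case: ifP.
- move=> _ /imsetP[X XL ->]; apply/imsetP; exists (svopp X); first exact: LN.
  by apply/ffunP=> e; rewrite !ffunE; case: ifP.
- move=> _ _ /imsetP[X XL ->] /imsetP[Y YL ->]; apply/imsetP.
  exists (svcomp X Y); first exact: LC.
  by apply/ffunP=> e; rewrite !ffunE; case: (e \in A).
- move=> _ _ e /imsetP[X XL ->] /imsetP[Y YL ->].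
  rewrite inE !ffunE; case: ifP => // eA sepe.
  have [|Z [ZL Ze Zf]] := LE X Y e XL YL; first by rewrite inE.
  exists (svrestr Z A); split; first by apply/imsetP; exists Z.
    by rewrite ffunE eA.
  move=> f; rewrite inE !ffunE; case: ifP => // fA sepf.
  by rewrite Zf ?inE // !ffunE.
Qed.

Lemma contraction_axioms L A :
  covector_axioms L -> covector_axioms (contraction L A).
Proof.
have vanishP X : reflect {in A, forall e, X e = Zero} (svrestr X A == sv0).
  apply: (iffP eqP) => [/ffunP h e eA|h].
    by have := h e; rewrite !ffunE eA.
  by apply/ffunP=> e; rewrite !ffunE; case: ifP => // /h.
case=> L0 LN LC LE; split.
- by rewrite inE L0; apply/vanishP => e _; rewrite ffunE.
- move=> X; rewrite !inE => /andP[/LN -> /vanishP X0]; apply/vanishP => e eA.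
  by rewrite ffunE X0.
- move=> X Y; rewrite !inE => /andP[XL /vanishP X0] /andP[YL /vanishP Y0].
  rewrite LC //; apply/vanishP => e eA; by rewrite ffunE X0 // Y0.
- move=> X Y e /setIdP[XL /vanishP X0] /setIdP[YL /vanishP Y0] sepe.
  have [Z [ZL Ze Zf]] := LE X Y e XL YL sepe.
  exists Z; split=> //; rewrite inE ZL; apply/vanishP => f fA.
  by rewrite Zf ?inE ?ffunE X0 // Y0.
Qed.

Lemma direct_sum_axioms k (A : 'I_k -> {set E}) (L : 'I_k -> {set signvec E}) :
  (forall i j, i != j -> [disjoint A i & A j]) ->
  (forall i X, X \in L i -> supp X \subset A i) ->
  (forall i, covector_axioms (L i)) ->
  covector_axioms (direct_sum A L).
Proof.
move=> disA suppL axL.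
have restrC X Y B : svrestr (svcomp X Y) B = svcomp (svrestr X B) (svrestr Y B).
  by apply/ffunP=> e; rewrite !ffunE; case: (e \in B).
have dsP X : reflect (supp X \subset \bigcup_i A i /\
                      forall i, svrestr X (A i) \in L i) (X \in direct_sum A L).
  by rewrite inE; apply: (iffP andP) => -[? /forallP ?].
split.
- apply/dsP; split; first by apply/subsetP=> e; rewrite inE ffunE.
  move=> i; suff -> : svrestr sv0 (A i) = sv0 by case: (axL i).
  by apply/ffunP=> e; rewrite !ffunE; case: ifP.
- move=> X /dsP[sX rX]; apply/dsP; split.
    apply: subset_trans sX; apply/subsetP=> e; rewrite !inE ffunE.
    by case: (X e).
  move=> i.
  suff -> : svrestr (svopp X) (A i) = svopp (svrestr X (A i)) by apply: (covN (axL i)).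
  by apply/ffunP=> e; rewrite !ffunE; case: ifP.
- move=> X Y /dsP[sX rX] /dsP[sY rY]; apply/dsP; split.
    apply/subsetP=> e; rewrite inE ffunE; case: ifP => [_|/negbT] h.
      by apply: (subsetP sY); rewrite inE.
    by move=> _; apply: (subsetP sX); rewrite inE.
  by move=> i; rewrite restrC; apply: (covC (axL i)).
- move=> X Y e /dsP[sX rX] /dsP[sY rY] sepe.
  have : e \in \bigcup_i A i.
    by apply: (subsetP sX); move: sepe; rewrite !inE => /andP[].
  case/bigcupP=> i _ eA.
  have [|Z [ZL Ze Zf]] := covE (axL i) (e := e) (rX i) (rY i).
    by move: sepe; rewrite !inE !ffunE eA.
  pose W : signvec E := [ffun f => if f \in A i then Z f else svcomp X Y f].
  exists W; split.
  + apply/dsP; split.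
      apply/subsetP=> f; rewrite inE ffunE; case: ifP => [fA _|_].
        by apply/bigcupP; exists i.
      rewrite ffunE; case: ifP => [_|/negbT] h.
        by apply: (subsetP sY); rewrite inE.
      by move=> _; apply: (subsetP sX); rewrite inE.
    move=> j; have [->|ji] := eqVneq j i.
      suff -> : svrestr W (A i) = Z by [].
      apply/ffunP=> f; rewrite !ffunE; case: (boolP (f \in A i)) => // fA.
      have [-> //|Zf0] := eqVneq (Z f) Zero.
      by rewrite (subsetP (suppL _ _ ZL)) ?inE in fA.
    suff -> : svrestr W (A j) = svcomp (svrestr X (A j)) (svrestr Y (A j)).
      exact: (covC (axL j)).
    rewrite -restrC; apply/ffunP=> f; rewrite !ffunE.
    case: (boolP (f \in A j)) => // fA.
    by rewrite (disjointFr (disA _ _ ji) fA).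
  + by rewrite ffunE eA.
  + move=> f fsep; rewrite ffunE; case: (boolP (f \in A i)) => // fA.
    rewrite Zf; first by rewrite !ffunE fA.
    by move: fsep; rewrite !inE !ffunE fA.
Qed.

End Minors.

Section Flags.
Variables (E : finType) (M : oriented_matroid E).

(* A flag F_1 < ... < F_k of flats distinct from the empty set and from E; the two
   extreme members F_0 = set0 and F_(k+1) = E are supplied by flag_nth. *)
Record flag := Flag {
  flag_seq :> seq {set E};
  flag_sorted : sorted (fun A B : {set E} => A \proper B) flag_seq;
  flag_flats :
    all (fun A => [&& A \in flats M, A != set0 & A != [set: E]]) flag_seq
}.

Definition flag_nth (F : flag) (i : nat) : {set E} := nth [set: E] (set0 :: F) i.

Lemma flag_nth_subset (F : flag) i j : (i <= j)%N -> flag_nth F i \subset flag_nth F j.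
Proof.
move=> ij; rewrite /flag_nth.
have [jF|jF] := ltnP j (size (set0 :: F)); last by rewrite (nth_default _ jF) subsetT.
have st : sorted (fun A B : {set E} => A \subset B) (set0 :: F).
  rewrite /=; case: F {jF} => [[//|A s] /= srt _]; rewrite sub0set /=.
  by apply: sub_path srt => ? ? /proper_sub.
apply: (sorted_leq_nth _ _ _ st) => //.
- by move=> ? ? ?; apply: subset_trans.
- by rewrite inE (leq_ltn_trans ij).
Qed.

Definition flag_step (F : flag) (i : 'I_(size F).+1) : {set E} :=
  flag_nth F i.+1 :\: flag_nth F i.

Definition flag_minor (F : flag) (i : 'I_(size F).+1) : {set signvec E} :=
  contraction (restriction M (flag_nth F i.+1)) (flag_nth F i).

Lemma initial_axioms (F : flag) :
  covector_axioms (direct_sum (@flag_step F) (@flag_minor F)).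
Proof.
apply: direct_sum_axioms.
- move=> i j; wlog ij : i j / (i < j)%N => [wh nij|_].
    have [ij|ji|/val_inj ij] := ltngtP i j; first exact: wh.
    + by rewrite disjoint_sym; apply: wh; rewrite // eq_sym.
    + by rewrite ij eqxx in nij.
  rewrite -setI_eq0; apply/eqP/setP => e; rewrite !inE; apply/negP.
  case/andP=> /andP[_ eFi] /andP[/negP eFj _]; apply: eFj.
  exact: (subsetP (flag_nth_subset F ij)).
- move=> i X; rewrite inE => /andP[/imsetP[Y _ ->] /eqP/ffunP X0].
  apply/subsetP=> e; have := X0 e; rewrite !inE !ffunE.
  by case: (e \in flag_nth F i) => [->|_]; rewrite ?eqxx //=; case: ifP.
- by move=> i; apply/contraction_axioms/restriction_axioms/covectorsP.
Qed.

Definition initial_matroid (F : flag) : oriented_matroid E :=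
  OrientedMatroid (initial_axioms F).

End Flags.

Section Fan.
Variables (R : realType) (E : finType).

Notation RE := {ffun E -> R^o}.

Definition indicator (A : {set E}) : RE := [ffun e => (e \in A)%:R].

Definition conic_hull (s : seq RE) (v : RE) : Prop :=
  exists a : 'I_(size s) -> R,
    (forall i, 0 <= a i) /\ v = \sum_(i < size s) a i *: s`_i.

Definition cone (M : oriented_matroid E) (F : flag M) : RE -> Prop :=
  conic_hull ([seq indicator A | A <- F]
              ++ [:: indicator [set: E]; - indicator [set: E]]).

(* Distinct flags have distinct cones, so the flags index the cones of the fan. *)
Definition cone_sub (M : oriented_matroid E) (F' F : flag M) : Prop :=
  forall v, cone F' v -> cone F v.

End Fan.

(* le plays the role of inclusion of the cones indexed by I. *)
Record cosheaf (I : Type) (le : I -> I -> Prop) := Cosheaf {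
  stalk : I -> zmodType;
  comap : forall t s, le t s -> {additive stalk s -> stalk t};
  comap_id : forall s (h : le s s) x, comap h x = x;
  comap_comp : forall r t s (hrt : le r t) (hts : le t s) (hrs : le r s) x,
    comap hrs x = comap hrt (comap hts x)
}.

Record cosheaf_hom (I : Type) (le : I -> I -> Prop) (A B : cosheaf le) := CosheafHom {
  hom_at :> forall s, {additive stalk A s -> stalk B s};
  hom_natural : forall t s (h : le t s) x,
    hom_at t (comap A h x) = comap B h (hom_at s x)
}.

Definition short_exact (I : Type) (le : I -> I -> Prop) (A B C : cosheaf le)
    (f : cosheaf_hom A B) (g : cosheaf_hom B C) : Prop :=
  forall s,
    [/\ injective (f s),
        forall y, g s y = 0 <-> exists x, f s x = y
      & forall z, exists y, g s y = z].

Record sub_of (V : zmodType) (S : zmodClosed V) := SubOf {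
  sub_val : V;
  sub_valP : sub_val \in S
}.
HB.instance Definition _ (V : zmodType) (S : zmodClosed V) :=
  [isSub for @sub_val V S].
HB.instance Definition _ (V : zmodType) (S : zmodClosed V) :=
  [Choice of sub_of S by <:].
HB.instance Definition _ (V : zmodType) (S : zmodClosed V) :=
  [SubChoice_isSubZmodule of sub_of S by <:].

Section Inclusion.
Variables (V : zmodType) (S T : zmodClosed V) (ST : {subset S <= T}).

Definition inclusion (x : sub_of S) : sub_of T := SubOf (ST (sub_valP x)).

Lemma inclusion_is_zmod_morphism : zmod_morphism inclusion.
Proof. by move=> x y; apply: val_inj. Qed.
HB.instance Definition _ :=
  GRing.isZmodMorphism.Build (sub_of S) (sub_of T) inclusion inclusion_is_zmod_morphism.

End Inclusion.

Definition has_inclusions (I : Type) (le : I -> I -> Prop) (V : zmodType)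
    (S : I -> zmodClosed V) : Prop :=
  forall t s, le t s -> {subset S s <= S t}.

Section InclusionCosheaf.
Variables (I : Type) (le : I -> I -> Prop) (V : zmodType) (S : I -> zmodClosed V).
Hypothesis hS : has_inclusions le S.

Lemma inclusion_id s (h : le s s) (x : sub_of (S s)) : inclusion (hS h) x = x.
Proof. exact: val_inj. Qed.

Lemma inclusion_comp r t s (hrt : le r t) (hts : le t s) (hrs : le r s)
    (x : sub_of (S s)) :
  inclusion (hS hrs) x = inclusion (hS hrt) (inclusion (hS hts) x).
Proof. exact: val_inj. Qed.

Definition inclusion_cosheaf : cosheaf le :=
  @Cosheaf I le (fun s => sub_of (S s)) (fun t s h => inclusion (hS h))
    inclusion_id inclusion_comp.

End InclusionCosheaf.

Definition is_inclusion (I : Type) (le : I -> I -> Prop) (V : zmodType)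
    (S T : I -> zmodClosed V) (hS : has_inclusions le S) (hT : has_inclusions le T)
    (f : cosheaf_hom (inclusion_cosheaf hS) (inclusion_cosheaf hT)) : Prop :=
  forall s (x : sub_of (S s)), sub_val (f s x) = sub_val x.

Definition subcosheaf (I : Type) (le : I -> I -> Prop) (V : zmodType)
    (S T : I -> zmodClosed V) (hS : has_inclusions le S) (hT : has_inclusions le T)
    : Prop :=
  exists f : cosheaf_hom (inclusion_cosheaf hS) (inclusion_cosheaf hT), is_inclusion f.

Notation chains E := {ffun signvec E -> int}.

Section VarchenkoGelfand.
Variable E : finType.
Implicit Types (N : oriented_matroid E) (c : chains E).

Definition tope_chains N : {pred chains E} :=
  [pred c : chains E | [forall T : signvec E, (c T != 0) ==> (T \in topes N)]].

Definition heaviside (e : E) (T : signvec E) : int := (T e == Plus)%:R.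

(* A linear function on Z[topes N] is given by its values on the topes, so only
   the restriction of f to topes N matters. As msize is the degree plus one (and 0
   for the zero polynomial), VG N k is the step of index k - 1 of the filtration:
   degree at most k - 1, and only the zero function for k = 0. *)
Definition VG N (k : nat) (f : signvec E -> int) : Prop :=
  exists m : {mpoly int[#|E|]}, (msize m <= k)%N /\
    forall T, T \in topes N -> f T = m.@[fun i => heaviside (enum_val i) T].

Definition tope_eval N (f : signvec E -> int) c : int :=
  \sum_(T in topes N) c T * f T.

Definition dual_VG N (p : nat) : {pred chains E} :=
  [pred c | (c \in tope_chains N) &&
            `[< forall f, VG N p f -> tope_eval N f c = 0 >]].

Lemma tope_chainsP N c :
  reflect (forall T : signvec E, c T != 0 -> T \in topes N) (c \in tope_chains N).
Proof.
by rewrite unfold_in /=; apply: (iffP forallP) => h T; apply/implyP; apply: h.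
Qed.

Lemma tope_chains_closed N : zmod_closed (tope_chains N).
Proof.
split=> [|c d /tope_chainsP hc /tope_chainsP hd]; apply/tope_chainsP => T.
  by rewrite ffunE eqxx.
have [cT _|/negPn/eqP cT] := boolP (c T != 0); first exact: hc.
rewrite !ffunE cT add0r oppr_eq0; exact: hd.
Qed.
HB.instance Definition _ N :=
  GRing.isZmodClosed.Build (chains E) (tope_chains N) (tope_chains_closed N).

Lemma dual_VG_closed N p : zmod_closed (dual_VG N p).
Proof.
split=> [|c d /andP[cN /asboolP hc] /andP[dN /asboolP hd]]; apply/andP; split.
- exact: rpred0.
- by apply/asboolP => f _; rewrite /tope_eval big1 // => T _; rewrite ffunE mul0r.
- exact: rpredB.
- apply/asboolP => f hf; rewrite -[RHS](subrr 0) -{1}(hc f hf) -(hd f hf).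
  by rewrite /tope_eval -sumrB; apply: eq_bigr => T _; rewrite !ffunE mulrBl.
Qed.
HB.instance Definition _ N p :=
  GRing.isZmodClosed.Build (chains E) (dual_VG N p) (dual_VG_closed N p).

End VarchenkoGelfand.

Definition ideal_generated (A : comNzRingType) (G : A -> Prop) (f : A) : Prop :=
  exists s : seq (A * A),
    (forall c, c \in s -> G c.2) /\ f = \sum_(c <- s) c.1 * c.2.

(* SFSym(E) is free on the square-free monomials x^S, and is represented by the
   coordinates in this basis. *)
Notation sfsym E := {ffun {set E} -> int}.

Section Cordovil.
Variable E : finType.
Implicit Types (N : oriented_matroid E) (c : sfsym E).

Definition dvar (e : E) : {mpoly int[#|E|]} := 'X_(enum_rank e).

Definition cordovil_generator N (g : {mpoly int[#|E|]}) : Prop :=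
  (exists e, g = dvar e ^+ 2) \/
  (exists2 C : signvec E, C \in signed_circuits N &
     g = \sum_(k in supp C) sint (C k) *: \prod_(j in supp C :\ k) dvar j).

Definition cordovil_ideal N : {mpoly int[#|E|]} -> Prop :=
  ideal_generated (cordovil_generator N).

Definition sf_mnm (S : {set E}) : 'X_{1..#|E|} :=
  [multinom (enum_val i \in S : nat) | i < #|E|].

(* The pairing kills the squares of the variables, hence is defined on Z[x*]. *)
Definition sf_pairing (f : {mpoly int[#|E|]}) c : int :=
  \sum_(S : {set E}) f@_(sf_mnm S) * c S.

Definition dual_cordovil N (p : nat) : {pred sfsym E} :=
  [pred c : sfsym E | [forall S : {set E}, (c S != 0) ==> (#|S| == p)] &&
    `[< forall f, cordovil_ideal N f -> f \is p.-homog -> sf_pairing f c = 0 >]].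

Lemma dual_cordovil_closed N p : zmod_closed (dual_cordovil N p).
Proof.
split=> [|c d /andP[/forallP cp /asboolP hc] /andP[/forallP dp /asboolP hd]];
  apply/andP; split.
- by apply/forallP => S; rewrite ffunE eqxx.
- by apply/asboolP => f _ _; rewrite /sf_pairing big1 // => S _; rewrite ffunE mulr0.
- apply/forallP => S; apply/implyP.
  have [cS _|/negPn/eqP cS] := boolP (c S != 0); first exact: (implyP (cp S)).
  by rewrite !ffunE cS add0r oppr_eq0; apply/implyP.
- apply/asboolP => f fI fp; rewrite -[RHS](subrr 0) -{1}(hc f fI fp) -(hd f fI fp).
  by rewrite /sf_pairing -sumrB; apply: eq_bigr => S _; rewrite !ffunE mulrBr.
Qed.
HB.instance Definition _ N p :=
  GRing.isZmodClosed.Build (sfsym E) (dual_cordovil N p) (dual_cordovil_closed N p).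

End Cordovil.

Section Stalks.
Variables (E : finType) (M : oriented_matroid E).

Definition sign_stalk (F : flag M) : zmodClosed (chains E) :=
  tope_chains (initial_matroid F).

Definition VG_stalk (p : nat) (F : flag M) : zmodClosed (chains E) :=
  dual_VG (initial_matroid F) p.

Definition cordovil_stalk (p : nat) (F : flag M) : zmodClosed (sfsym E) :=
  dual_cordovil (initial_matroid F) p.

End Stalks.

(* Main.v *)
Require Import Defs.
From HB Require Import structures.
From mathcomp Require Import all_boot all_order all_algebra.
From mathcomp Require Import boolp reals.
From mathcomp Require Import mpoly.

Set Implicit Arguments.
Unset Strict Implicit.
Unset Printing Implicit Defensive.

Import Order.TTheory GRing.Theory Num.Theory.
Local Open Scope ring_scope.

(** Write [h^S] for the product of the Heaviside functions [h_e], [e] in [S], and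
    call the value of a chain of topes on [h^S] its moment at [S].

    The map onto the Cordovil cosheaf sends a chain [c] to its [leading] form of
    degree [p], the family of its moments at the sets of size [p].  As [h_e] is
    idempotent, a chain belongs to the [p]-th step of the dual filtration exactly
    when its moments at all smaller sets vanish ([dual_VGP]); hence the kernel of
    [leading p] on this step is the next step.  The image satisfies the circuit
    relations ([leading_cordovil]): no tope agrees with a signed circuit or with
    its opposite, so two products of functions [h_k] and [h_k - 1] over the
    circuit vanish on topes, and their difference has the circuit relation as its
    top degree part.

    The main point is that [leading p] is surjective over the integers
    ([leading_surjective]).  Order [E].  The circuit relations determine an element
    of the dual Cordovil algebra from its coefficients at the sets containing no
    broken circuit ([straightening]).  For such a set [S] consider, for each [e], a
    covector with zero set the flat spanned by the elements of [S] after [e].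
    Composing these covectors in order, with independent signs for those that
    belong to [S], gives a cube of topes, and the alternating sum over the cube is
    a chain [dual_chain S] in step [#|S|].  Its moment at [S] is a sign, and its
    other nonzero moments at sets of the same size occur at sets of larger
    [weight].  Being unitriangular, these chains realize every element.  That a set
    failing the condition on spanned flats contains a broken circuit rests on
    [circuit_of_closure], a fragment of oriented matroid duality with a short
    direct proof.  So neither a rank count nor the number of topes enters.

    For the cosheaf maps, an inclusion of cones means an inclusion of flags
    ([cone_sub_flag]), and refining a flag shrinks the set of topes of the initial
    matroid ([initial_topes_mono]), hence the steps of the filtration.  That the
    Cordovil stalks shrink as well follows from surjectivity, since the formula for
    the leading form is the same on all stalks. *)

(** * Covectors, closures and circuits *)

Section SignVectorFacts.
Variable E : finType.
Implicit Types (X Y : signvec E).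

Lemma soppK : involutive sopp.
Proof. by case. Qed.

Lemma sopp_eq0 s : (sopp s == Zero) = (s == Zero).
Proof. by case: s. Qed.

Lemma sint_eq0 s : (sint s == 0) = (s == Zero).
Proof. by case: s. Qed.

Lemma orthogonalP X Y :
  reflect ((forall e, X e = Zero \/ Y e = Zero) \/
           (exists e, X e != Zero /\ Y e = X e) /\
           (exists f, X f != Zero /\ Y f = sopp (X f)))
          (Defs.orthogonal X Y).
Proof.
apply: (iffP orP) => -[h|h]; [left|right|left|right].
- move=> e; have := forallP h e.
  by rewrite mulf_eq0 !sint_eq0 => /orP[] /eqP ->; [left|right].
- have [e /existsP[f /andP[he hf]]] := existsP h.
  split; [exists e | exists f].
    by move: he; case: (X e); case: (Y e).
  by move: hf; case: (X f); case: (Y f).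
- by apply/forallP => e; case: (h e) => ->; rewrite ?mul0r ?mulr0.
- have [[e [Xe Ye]] [f [Xf Yf]]] := h.
  apply/existsP; exists e; apply/existsP; exists f; rewrite Ye Yf.
  by move: Xe Xf; case: (X e); case: (X f).
Qed.

Definition compose_list (s : seq (signvec E)) : signvec E :=
  foldr (@svcomp E) sv0 s.

Lemma compose_listE s e :
  compose_list s e =
  nth sv0 s (find (fun X => X e != Zero) s) e.
Proof.
elim: s => [|X s IHs] /=; first by rewrite ffunE.
by rewrite ffunE IHs; case: (X e == Zero).
Qed.

Lemma compose_list_eq0 s e :
  (compose_list s e == Zero) = all (fun X => X e == Zero) s.
Proof.
elim: s => [|X s IHs] /=; first by rewrite ffunE.
by rewrite ffunE -IHs; case Xe: (X e == Zero).
Qed.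

Lemma compose_list_covector (L : {set signvec E}) s :
  covector_axioms L -> all (mem L) s -> compose_list s \in L.
Proof.
move=> Lax; elim: s => [|X s IHs] /=; first by rewrite (cov0 Lax).
by case/andP=> XL sL; apply: (covC Lax) => //; apply: IHs.
Qed.

End SignVectorFacts.

Section Closure.
Variables (E : finType) (N : oriented_matroid E).
Implicit Types (A B S : {set E}) (X Y T C V W : signvec E).

Definition vanishes A X := [forall e in A, X e == Zero].

Lemma vanishesP A X : reflect {in A, forall e, X e = Zero} (vanishes A X).
Proof. by apply: (iffP forall_inP) => h e /h /eqP. Qed.

Definition in_closure A e : bool :=
  [forall X in covectors N, vanishes A X ==> (X e == Zero)].

Lemma in_closureP A e :
  reflect (forall X, X \in covectors N -> {in A, forall a, X a = Zero} ->
             X e = Zero)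
          (in_closure A e).
Proof.
apply: (iffP forall_inP) => h X XN; last first.
  by apply/implyP => /vanishesP hX; rewrite (h X XN hX).
by move=> /vanishesP hX; apply/eqP; apply: (implyP (h X XN)).
Qed.

(** A covector whose zero set is the flat spanned by [A]. *)
Definition generic A : signvec E :=
  compose_list (enum [set X in covectors N | vanishes A X]).

Lemma generic_covector A : generic A \in covectors N.
Proof.
apply: compose_list_covector (covectorsP N) _.
by apply/allP => X; rewrite mem_enum inE => /andP[].
Qed.

Lemma generic_eq0 A e : (generic A e == Zero) = in_closure A e.
Proof.
rewrite /generic compose_list_eq0; apply/allP/forall_inP => h X.
  by move=> XN; apply/implyP => hX; apply: h; rewrite mem_enum inE XN.
by rewrite mem_enum inE => /andP[XN hX]; apply: (implyP (h X XN)).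
Qed.

Lemma generic_vanishes A : {in A, forall e, generic A e = Zero}.
Proof. by move=> e eA; apply/eqP; rewrite generic_eq0; apply/in_closureP => X _ ->. Qed.

(** For a pattern [W] without zeros on [B], take a covector that agrees with [W] on
    as large a part of [B] as possible and vanishes on the rest of [B].  If the
    rest is not empty, [W] restricted to it is not a vector, so some covector is
    not orthogonal to it, and composing with this covector or its opposite
    enlarges the part.  Zeros of [W] are then produced one at a time, by
    eliminating between the two patterns with opposite signs at the zero: these
    agree on the rest of [B], so elimination leaves them unchanged there. *)
Lemma all_patterns_of_independent B :
  (forall V, V \in vectors N -> supp V \subset B -> V = sv0) ->
  forall W, exists2 X, X \in covectors N & {in B, X =1 W}.
Proof.
move=> indepB.
have full W : {in B, forall e, W e != Zero} ->
    exists2 X, X \in covectors N & {in B, X =1 W}.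
  move=> Wfull.
  pose conf X := (X \in covectors N) && [forall e in B, (X e == Zero) || (X e == W e)].
  have conf0 : conf sv0.
    rewrite /conf (cov0 (covectorsP N)); apply/forall_inP => e _.
    by rewrite ffunE eqxx.
  case: (arg_maxnP (fun X => #|supp X :&: B|) conf0) => X /andP[XN /forall_inP confX] Xmax.
  exists X => // e eB; apply/eqP; apply: contraT => XWe.
  have Xe0 : X e = Zero by have := confX e eB; rewrite (negPf XWe) orbF => /eqP.
  pose V : signvec E := [ffun f => if (f \in B) && (X f == Zero) then W f else Zero].
  have : V \notin vectors N.
    apply/negP => /indepB -/(_ _)/ffunP V0.
    have : V e = Zero.
      rewrite V0 ?ffunE //; apply/subsetP => f.
      by rewrite inE ffunE; case: (f \in B).
    by rewrite ffunE eB Xe0 eqxx /=; apply/eqP/Wfull.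
  rewrite inE => /forall_inPn[Y YN /orthogonalP northo].
  (* Up to sign, Y agrees with V wherever both are nonzero. *)
  have [Z ZN [Zconf [f Vf Zf]]] : exists2 Z, Z \in covectors N &
      (forall g, V g != Zero -> Z g = Zero \/ Z g = V g) /\
      (exists2 f, V f != Zero & Z f = V f).
    have [g [Vg Yg]] : exists g, V g != Zero /\ Y g != Zero.
      case: (boolP [exists g, (V g != Zero) && (Y g != Zero)]).
        by case/existsP => g /andP[]; exists g.
      move=> /existsPn nVY; case: northo; left => g.
      by have := nVY g; rewrite negb_and !negbK => /orP[] /eqP; [left|right].
    have signs h : V h != Zero -> [\/ Y h = Zero, Y h = V h | Y h = sopp (V h)].
      by case: (V h); case: (Y h) => // _; by [constructor 1|constructor 2|constructor 3].
    case: (signs g Vg) => Yg'; first by rewrite Yg' in Yg.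
      exists Y => //; split; last by exists g.
      move=> h Vh; case: (signs h Vh) => Yh; [by left|by right|].
      by case: northo; right; split; [exists g|exists h].
    exists (svopp Y); first exact: (covN (covectorsP N)).
    split; last by exists g => //; rewrite ffunE Yg' soppK.
    move=> h Vh; rewrite ffunE; case: (signs h Vh) => Yh.
    - by left; rewrite Yh.
    - by case: northo; right; split; [exists h|exists g].
    - by right; rewrite Yh soppK.
  have /Xmax : conf (svcomp X Z).
    rewrite /conf (covC (covectorsP N)) //; apply/forall_inP => g gB.
    rewrite ffunE; have [Xg|Xg] := eqVneq (X g) Zero; last exact: confX.
    have Vg : V g = W g by rewrite ffunE gB Xg eqxx.
    have [|->|->] := Zconf g; rewrite ?Vg ?eqxx ?orbT //; exact: Wfull.
  rewrite /= leqNgt => /negP[]; apply: proper_card; apply/properP; split.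
    apply/subsetP => g; rewrite !inE ffunE => /andP[Xg ->].
    by rewrite (negPf Xg) Xg.
  have /andP[fB Xf] : (f \in B) && (X f == Zero).
    by apply: contraNT Vf => /negPf h; rewrite ffunE h.
  by exists f; rewrite !inE ?ffunE Xf // Zf Vf fB.
move=> W; move nE : #|[set e in B | W e == Zero]| => n.
elim: n W nE => [|n IHn] W nE.
  apply: full => e eB; apply/negP => We.
  by move/eqP: nE; rewrite cards_eq0 => /eqP/setP/(_ e); rewrite !inE eB We.
have [e] : exists e, e \in [set e in B | W e == Zero].
  by apply/set0Pn; rewrite -card_gt0 nE.
rewrite inE => /andP[eB We].
pose put s : signvec E := [ffun f => if f == e then s else W f].
have putP s : s != Zero -> exists2 X, X \in covectors N & {in B, X =1 put s}.
  move=> s0; apply: IHn; apply/eqP; rewrite -eqSS -nE.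
  rewrite (cardsD1 e [set f in B | W f == Zero]) inE eB We add1n eqSS.
  apply/eqP/eq_card => f; rewrite !inE ffunE.
  by case: (eqVneq f e) => //= _; rewrite (negPf s0) andbF.
have [X XN hX] := putP Plus isT.
have [Y YN hY] := putP Minus isT.
have [|Z [ZN Ze hZ]] := covE (covectorsP N) XN YN (e := e).
  by rewrite inE hX // hY // !ffunE eqxx.
exists Z => // f fB; have [->|fe] := eqVneq f e; first by rewrite Ze (eqP We).
have XW : X f = W f by rewrite hX // ffunE (negPf fe).
have YW : Y f = W f by rewrite hY // ffunE (negPf fe).
rewrite hZ ?ffunE ?XW ?YW ?if_same // inE XW YW.
by case: (W f).
Qed.

(** The part of oriented matroid duality needed here.  Shrink [A] to a minimal set
    with [e] in its closure.  Then [e |: A] carries a nonzero vector, as otherwise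
    the pattern that is nonzero only at [e] would come from a covector.  One of
    minimal support is a signed circuit, and its support contains [e]: otherwise
    orthogonality to it would put some element of [A] in the closure of the
    others, against the minimality of [A]. *)
Lemma circuit_of_closure A e :
  in_closure A e -> e \notin A ->
  exists2 C, C \in signed_circuits N & e \in supp C /\ supp C \subset e |: A.
Proof.
move=> clAe eA.
pose ok A' := (A' \subset A) && in_closure A' e.
have okA : ok A by rewrite /ok subxx.
case: (arg_minnP (fun A' => #|A'|) okA) => A' /andP[sA' clA'] A'min.
have eA' : e \notin A' by apply: contra eA; apply: (subsetP sA').
pose nz V := [&& V \in vectors N, V != sv0 & supp V \subset e |: A'].
have [V0 nzV0] : exists V, nz V.
  apply/existsP; apply: contraT => /existsPn none.
  have [|X XN hX] := @all_patterns_of_independent (e |: A') _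
      [ffun f => if f == e then Plus else Zero].
    move=> V VN sV; apply/eqP; have := none V.
    by rewrite /nz VN sV andbT /= negbK.
  have := hX e (setU11 _ _); rewrite ffunE eqxx.
  rewrite (in_closureP _ _ clA') // => a aA'.
  rewrite hX ?setU1r // ffunE; case: eqP => // ae.
  by rewrite -ae aA' in eA'.
case: (arg_minnP (fun V => #|supp V|) nzV0) => V /and3P[VN V0' sV] Vmin.
exists V.
  rewrite inE VN V0'; apply/forall_inP => X XN; apply/implyP => /andP[X0 sX].
  rewrite eqEcard sX Vmin // /nz XN X0; exact: subset_trans sX sV.
split; last by apply: subset_trans sV _; apply: setUS.
apply: contraT => eV.
have sVA' : supp V \subset A'.
  apply/subsetP => f fV; have := subsetP sV f fV; rewrite !inE.
  by case: eqP => // fe; rewrite -fe fV in eV.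
have [a aV] : exists a, a \in supp V.
  apply/set0Pn; apply: contra V0' => /eqP sV0; apply/eqP/ffunP => f.
  by apply/eqP; move/setP/(_ f): sV0; rewrite !inE ffunE => /negbFE.
have aA' := subsetP sVA' a aV.
have : ok (A' :\ a).
  rewrite /ok (subset_trans (subD1set _ _) sA'); apply/in_closureP => X XN hX.
  apply: (in_closureP _ _ clA') => // f fA'.
  have [->|fa] := eqVneq f a; last by apply: hX; rewrite !inE fa.
  apply/eqP; apply: contraT => Xa.
  have onlya g : V g != Zero -> X g != Zero -> g = a.
    move=> Vg; apply: contraNeq => ga; rewrite hX // !inE ga /=.
    by apply: (subsetP sVA'); rewrite inE.
  move: VN; rewrite inE => /forall_inP/(_ X XN)/orthogonalP[/(_ a)[Va|Xa0]|].
  - by rewrite inE Va in aV.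
  - by rewrite Xa0 in Xa.
  - case=> -[g [Vg Xg]] [h [Vh Xh]].
    have ga : g = a by apply: onlya; rewrite ?Xg.
    have ha : h = a by apply: onlya; rewrite ?Xh ?sopp_eq0.
    by move: Xh; rewrite ha -ga Xg; move: Vg; case: (V g).
move/A'min; rewrite leqNgt => /negP[]; apply: proper_card.
exact: properD1.
Qed.

Lemma full_compose : loopless N ->
  exists2 W, W \in covectors N & forall e, W e != Zero.
Proof.
move=> lN; exists (generic set0); first exact: generic_covector.
move=> e; rewrite generic_eq0; apply/negP => /in_closureP h.
by have [X XN []] := lN e; apply: h => // a; rewrite inE.
Qed.

(** Composing a tope with a covector without zeros cannot enlarge it. *)
Lemma topesP T : loopless N ->
  reflect (T \in covectors N /\ forall e, T e != Zero) (T \in topes N).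
Proof.
move=> lN; rewrite inE; apply: (iffP andP) => -[TN hT]; split => //.
  have [W WN Wfull] := full_compose lN.
  have TW : svcomp T W \in covectors N by apply: (covC (covectorsP N)).
  have /eqP/ffunP TWT : svcomp T W == T.
    apply: (implyP (forall_inP hT _ TW)); apply/forallP => e.
    by rewrite ffunE; case: eqP => //=.
  by move=> e; rewrite -TWT ffunE; case: ifP => [_|/negbT] //; apply: Wfull.
apply/forall_inP => X XN; apply/implyP => /forallP TX; apply/eqP/ffunP => e.
by have := TX e; rewrite (negPf (hT e)) => /eqP.
Qed.

End Closure.

(** * Topes of initial matroids and cones of the fan *)

Section InitialTopes.
Variables (E : finType) (M : oriented_matroid E).
Implicit Types (F : flag M) (A : {set E}) (X Y T : signvec E) (e : E).

Definition erase A T : signvec E := svrestr T (~: A).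

Lemma eraseE A T e : erase A T e = if e \in A then Zero else T e.
Proof. by rewrite ffunE inE; case: (e \in A). Qed.

Lemma flag_nth_last F : flag_nth F (size F).+1 = [set: E].
Proof. by rewrite /flag_nth nth_default. Qed.

Lemma flag_stepP F e : exists i : 'I_(size F).+1, e \in flag_step i.
Proof.
have ex : exists i, e \in flag_nth F i.
  by exists (size F).+1; rewrite flag_nth_last inE.
case: (ex_minnP ex) => -[|i] ei imin; first by rewrite inE in ei.
have iF : (i < (size F).+1)%N.
  by apply: imin; rewrite flag_nth_last inE.
exists (Ordinal iF); rewrite inE ei andbT.
by apply/negP => /imin; rewrite ltnn.
Qed.

Lemma flag_step_inj F e (i j : 'I_(size F).+1) :
  e \in flag_step i -> e \in flag_step j -> i = j.
Proof.
rewrite !inE => /andP[ei ei1] /andP[ej ej1]; apply/ord_inj.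
case: (ltngtP i j) => // ij.
  by rewrite (subsetP (flag_nth_subset F ij) _ ei1) in ej.
by rewrite (subsetP (flag_nth_subset F ij) _ ej1) in ei.
Qed.

Lemma initial_covectorP F X :
  reflect (forall i : 'I_(size F).+1, exists2 Y, Y \in covectors M &
             {in flag_nth F i, forall e, Y e = Zero} /\ {in flag_step i, Y =1 X})
          (X \in covectors (initial_matroid F)).
Proof.
have sX : supp X \subset \bigcup_i flag_step (F := F) i.
  apply/subsetP => e _; have [i ei] := flag_stepP F e.
  by apply/bigcupP; exists i.
rewrite inE sX; apply: (iffP forallP) => h i.
  have := h i; rewrite inE => /andP[/imsetP[Y YM /ffunP XY] /eqP/ffunP X0].
  exists Y => //; split=> e ei.
    have := XY e; have := X0 e; rewrite !ffunE ei => ->.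
    by rewrite (subsetP (flag_nth_subset F (leqnSn i)) _ ei).
  by have := XY e; rewrite !ffunE ei; move: ei; rewrite inE => /andP[_ ->].
have [Y YM [Y0 YX]] := h i; rewrite inE; apply/andP; split.
  apply/imsetP; exists Y => //; apply/ffunP => e; rewrite !ffunE.
  case: ifP => [ei|]; first by rewrite YX //; move: ei; rewrite inE => /andP[_ ->].
  rewrite inE; case: (boolP (e \in flag_nth F i)) => [ei _|_ /= ->] //.
  by rewrite Y0 // if_same.
apply/eqP/ffunP => e; rewrite !ffunE; case: ifP => // ei.
by rewrite inE ei.
Qed.

Hypothesis M_loopless : loopless M.

Lemma flag_nth_flat F (i : 'I_(size F).+1) :
  exists2 Y, Y \in covectors M & forall e, (Y e == Zero) = (e \in flag_nth F i).
Proof.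
case: i => -[|i] iF.
  have [W WM W0] := full_compose M_loopless.
  by exists W => // e; rewrite (negPf (W0 e)) inE.
have := allP (flag_flats F) (nth [set: E] F i); rewrite mem_nth // => /(_ isT).
case/and3P => /imsetP[Y YM FY] _ _; exists Y => // e.
by rewrite /flag_nth /= FY !inE negbK.
Qed.

Lemma initial_loopless F : loopless (initial_matroid F).
Proof.
move=> e; have [i ei] := flag_stepP F e.
have [Y YM Y0] := flag_nth_flat i.
exists (svrestr Y (flag_step i)); last first.
  apply/eqP; rewrite ffunE ei Y0.
  by move: ei; rewrite inE => /andP[].
apply/initial_covectorP => j; have [<-|ij] := eqVneq i j.
  exists Y => //; split=> f fi; last by rewrite ffunE fi.
  by apply/eqP; rewrite Y0.
exists sv0; first exact: (cov0 (covectorsP M)).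
split=> f fj; rewrite !ffunE //.
by case: ifP => // fi; rewrite (flag_step_inj fi fj) eqxx in ij.
Qed.

(** On each step of the flag, a tope of the initial matroid is given by a covector
    of [M] vanishing on the smaller flat of the step; erasing a member of the flag
    leaves the composition of those covectors that belong to the later steps, the
    last one first.  This description involves the flag only through its set of
    members, which makes the topes of flags comparable. *)
Lemma initial_topesP F T :
  reflect [/\ forall e, T e != Zero, T \in covectors M &
              {in flag_seq F, forall A, erase A T \in covectors M}]
          (T \in topes (initial_matroid F)).
Proof.
apply: (iffP (topesP _ (initial_loopless F))).
  case=> /initial_covectorP TF T0.
  have er k : (k <= (size F).+1)%N ->
      erase (flag_nth F ((size F).+1 - k)) T \in covectors M.
    elim: k => [_|k IHk kF].
      rewrite subn0 flag_nth_last.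
      suff -> : erase [set: E] T = sv0 by apply: (cov0 (covectorsP M)).
      by apply/ffunP => e; rewrite eraseE inE ffunE.
    (* Going down from the top of the flag, one more covector is composed. *)
    have iF : ((size F).+1 - k.+1 < (size F).+1)%N by rewrite ltn_subrL.
    have iS : ((size F).+1 - k = ((size F).+1 - k.+1).+1)%N by rewrite -subSn // subSS.
    have [Y YM /= [Y0 YT]] := TF (Ordinal iF).
    move/IHk: (ltnW kF); rewrite iS => eM.
    set i := (_ - k.+1)%N in iF Y0 YT eM *.
    suff -> : erase (flag_nth F i) T = svcomp (erase (flag_nth F i.+1) T) Y.
      exact: (covC (covectorsP M)).
    apply/ffunP => e; rewrite [RHS]ffunE !eraseE.
    case: ifP => [ei|/negbT ei].
      by rewrite (subsetP (flag_nth_subset F (leqnSn i)) _ ei) eqxx Y0.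
    case: (boolP (e \in flag_nth F i.+1)) => [ei1|_]; first by rewrite eqxx YT // inE ei.
    by rewrite (negPf (T0 e)).
  split=> // [|A AF].
    suff <- : erase (flag_nth F 0) T = T by rewrite -(subnn (size F).+1) er.
    by apply/ffunP => e; rewrite eraseE inE.
  have iA : (index A F < size F)%N by rewrite index_mem.
  suff <- : flag_nth F ((size F).+1 - (size F - index A F)) = A.
    by apply: er; rewrite (leq_trans (leq_subr _ _)).
  by rewrite subSn ?leq_subr // subKn ?(ltnW iA) // /flag_nth /= nth_index.
case=> T0 TM hT; split=> //; apply/initial_covectorP => -[i iF].
exists (erase (flag_nth F i) T); last first.
  by split=> e; rewrite eraseE; [move->|rewrite inE => /andP[/negPf ->]].
case: i iF => [|i] iF; last by apply: hT; apply: mem_nth.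
suff -> : erase (flag_nth F 0) T = T by [].
by apply/ffunP => e; rewrite eraseE inE.
Qed.

Lemma initial_topes_mono (F F' : flag M) :
  {subset flag_seq F' <= flag_seq F} ->
  {subset topes (initial_matroid F) <= topes (initial_matroid F')}.
Proof.
move=> F'F T /initial_topesP[T0 TM hT]; apply/initial_topesP; split=> // A AF'.
by apply: hT; apply: F'F.
Qed.

End InitialTopes.

Section Cones.
Variables (R : realType) (E : finType) (M : oriented_matroid E).
Implicit Types (F : flag M) (A : {set E}).

Lemma mem_conic_hull (s : seq {ffun E -> R^o}) v : v \in s -> conic_hull s v.
Proof.
move=> vs; have iv : (index v s < size s)%N by rewrite index_mem.
exists (fun i => (i == Ordinal iv)%:R); split=> [i|]; first exact: ler0n.
rewrite (bigD1 (Ordinal iv)) //= eqxx scale1r nth_index // big1 ?addr0 //.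
by move=> i /negPf ->; rewrite scale0r.
Qed.

(** The generators of the cone are monotone for the preorder on [E] in which [f]
    lies above [e] when all members of the flag containing [e] contain [f], and
    monotone functions form a cone. *)
Lemma cone_mono F (v : {ffun E -> R^o}) e f : cone F v ->
  {in flag_seq F, forall A, e \in A -> f \in A} -> (v e : R) <= v f.
Proof.
case=> a [a0 ->] ef; rewrite !sum_ffunE; apply: ler_sum => i _.
rewrite !ffunE; apply: ler_wpM2l => //.
have := mem_nth 0 (ltn_ord i); rewrite mem_cat => /orP[/mapP[A AF ->]|].
  by rewrite !ffunE ler_nat; case: (boolP (e \in A)) => // /(ef A AF) ->.
by rewrite !inE => /orP[] /eqP ->; rewrite !ffunE !inE.
Qed.

(** By monotonicity every element of [A] is separated from every element outside
    [A] by a member of the flag.  Let [e0] in [A] lie in as few members as possible;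
    the first member containing [e0] contains [A], and it has no element outside
    [A] since a member separating it from [e0] is larger. *)
Lemma indicator_in_cone F A : A != set0 -> A != [set: E] ->
  cone F (indicator R A) -> A \in flag_seq F.
Proof.
move=> A0 AT coneA.
have sepA e f : e \in A -> f \notin A ->
    exists2 B, B \in flag_seq F & (e \in B) && (f \notin B).
  move=> eA fA; case: (boolP (has (fun B : {set E} => (e \in B) && (f \notin B)) F)).
    by case/hasP => B BF h; exists B.
  move/hasPn => h; have := cone_mono coneA (e := e) (f := f).
  rewrite !ffunE eA (negPf fA) ler10 => le; have // : false.
  by apply: le => B /h; rewrite negb_and negbK; case: (e \in B).
have [e1 e1A] : exists e, e \in A by apply/set0Pn.
have [f1 f1A] : exists f, f \notin A.
  have [f _ fA] : exists2 f, f \in [set: E] & f \notin A.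
    by apply/subsetPn; rewrite subTset.
  by exists f.
pose idx e := find (fun B : {set E} => e \in B) F.
case: (arg_maxnP idx e1A) => e0 e0A e0max.
have mono i j : (i <= j)%N -> nth [set: E] F i \subset nth [set: E] F j.
  by move=> ij; apply: (flag_nth_subset F (i := i.+1) (j := j.+1)).
have inF e : e \in A -> (idx e < size F)%N.
  move=> eA; have [B BF /andP[eB _]] := sepA e f1 eA f1A.
  by rewrite -has_find; apply/hasP; exists B.
suff -> : A = nth [set: E] F (idx e0) by rewrite mem_nth ?inF.
apply/eqP; rewrite eqEsubset; apply/andP; split; apply/subsetP => e eA.
  apply: (subsetP (mono _ _ (e0max e eA))).
  by apply: (nth_find [set: E] (a := fun B : {set E} => e \in B)); rewrite has_find inF.
apply: contraT => eA'; have [B BF /andP[e0B eB]] := sepA e0 e e0A eA'.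
case/negP: eB; rewrite -(nth_index [set: E] BF); apply: (subsetP (mono _ _ _)) eA.
rewrite leqNgt; apply/negP => /(before_find [set: E]).
by rewrite nth_index // e0B.
Qed.

Lemma cone_sub_flag (F' F : flag M) : cone_sub R F' F ->
  {subset flag_seq F' <= flag_seq F}.
Proof.
move=> sub A AF'; have /and3P[_ A0 AT] := allP (flag_flats F') A AF'.
apply: indicator_in_cone => //; apply: sub; apply: mem_conic_hull.
by rewrite mem_cat map_f.
Qed.

End Cones.

(** * The two stalks in terms of square-free monomials *)

Section SquareFree.
Variable E : finType.
Implicit Types (A B S U : {set E}) (T : signvec E) (u : 'X_{1..#|E|}).

Lemma sf_mnmE S e : sf_mnm S (enum_rank e) = (e \in S).
Proof. by rewrite mnmE enum_rankK. Qed.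

Lemma mnm_ext u (v : 'X_{1..#|E|}) :
  (forall e : E, u (enum_rank e) = v (enum_rank e)) -> u = v.
Proof. by move=> uv; apply/mnmP => i; rewrite -[i]enum_valK uv. Qed.

Lemma prod_dvar B : \prod_(j in B) dvar j = 'X_[sf_mnm B].
Proof.
rewrite mpolyXE_id (reindex (@enum_rank E)) /=; last exact/onW_bij/enum_rank_bij.
by rewrite big_mkcond; apply: eq_bigr => e _; rewrite sf_mnmE; case: (e \in B).
Qed.

Lemma mdeg_ranks u : mdeg u = (\sum_(e : E) u (enum_rank e))%N.
Proof. by rewrite mdegE (reindex (@enum_rank E)) //; apply/onW_bij/enum_rank_bij. Qed.

Lemma mdeg_sf_mnm S : mdeg (sf_mnm S) = #|S|.
Proof.
rewrite mdeg_ranks -sum1_card [RHS]big_mkcond; apply: eq_bigr => e _.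
by rewrite sf_mnmE; case: (e \in S).
Qed.

Definition mnm_set u : {set E} := [set e | u (enum_rank e) != 0%N].

Lemma mnm_set_sf S : mnm_set (sf_mnm S) = S.
Proof. by apply/setP => e; rewrite inE sf_mnmE; case: (e \in S). Qed.

Lemma card_mnm_set u : (#|mnm_set u| <= mdeg u)%N.
Proof.
rewrite mdeg_ranks -sum1_card big_mkcond; apply: leq_sum => e _.
by rewrite inE; case: (u _).
Qed.

Lemma heavisideX (e : E) T n : heaviside e T ^+ n = if n == 0%N then 1 else heaviside e T.
Proof. by case: n => [|n] //=; rewrite /heaviside; case: eqP; rewrite ?expr1n ?expr0n. Qed.

Definition hmon U T : int := \prod_(e in U) heaviside e T.

Lemma hmonU A B T : hmon A T * hmon B T = hmon (A :|: B) T.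
Proof.
rewrite /hmon !(big_mkcond (fun e => e \in _)) -big_split; apply: eq_bigr => e _ /=.
rewrite inE; case: (e \in A); case: (e \in B); rewrite ?mulr1 ?mul1r //=.
by rewrite /heaviside; case: eqP; rewrite ?mulr1 ?mul0r.
Qed.

(** As the Heaviside functions are idempotent, the exponents do not matter. *)
Lemma meval_heaviside u T :
  'X_[u].@[fun i => heaviside (enum_val i) T] = hmon (mnm_set u) T.
Proof.
rewrite mevalX (reindex (@enum_rank E)) /=; last exact/onW_bij/enum_rank_bij.
rewrite /hmon [RHS]big_mkcond; apply: eq_bigr => e _.
by rewrite enum_rankK heavisideX inE; case: eqP.
Qed.

Definition moment U (c : chains E) : int := \sum_T c T * hmon U T.

Lemma moment_is_zmod_morphism U : zmod_morphism (moment U).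
Proof.
move=> c d; rewrite /moment -sumrB; apply: eq_bigr => T _.
by rewrite !ffunE mulrBl.
Qed.
HB.instance Definition _ U :=
  GRing.isZmodMorphism.Build (chains E) int (moment U) (moment_is_zmod_morphism U).

Lemma tope_evalE (N : oriented_matroid E) f c : c \in tope_chains N ->
  tope_eval N f c = \sum_T c T * f T.
Proof.
move=> /tope_chainsP cN; rewrite /tope_eval big_mkcond; apply: eq_bigr => T _.
case: ifPn => // TN; have [->|/cN] := eqVneq (c T) 0; first by rewrite mul0r.
by rewrite (negPf TN).
Qed.

(** A polynomial of degree less than [p] takes the same values as a combination of
    square-free monomials of degree less than [p]. *)
Lemma dual_VGP (N : oriented_matroid E) p c :
  reflect (c \in tope_chains N /\ forall U, (#|U| < p)%N -> moment U c = 0)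
          (c \in dual_VG N p).
Proof.
apply: (iffP andP) => -[cN]; last first.
  move=> hU; split=> //; apply/asboolP => f [m [mp fm]].
  transitivity (\sum_(T in topes N) \sum_(u <- msupp m) m@_u * (c T * hmon (mnm_set u) T)).
    apply: eq_bigr => T TN; rewrite fm // {1}[m]mpolyE raddf_sum mulr_sumr.
    by apply: eq_bigr => u _; rewrite /= mevalZ meval_heaviside mulrCA.
  rewrite exchange_big /= big_seq big1 // => u um; rewrite -mulr_sumr.
  have := tope_evalE (hmon (mnm_set u)) cN; rewrite /tope_eval => ->.
  rewrite [X in _ * X]hU ?mulr0 //.
  exact: leq_ltn_trans (card_mnm_set u) (leq_trans (msize_mdeg_lt um) mp).
move/asboolP => cVG; split=> // U Up; rewrite -[RHS](cVG (hmon U)); last first.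
  exists 'X_[sf_mnm U]; rewrite msizeX mdeg_sf_mnm; split=> // T _.
  by rewrite meval_heaviside mnm_set_sf.
by rewrite tope_evalE.
Qed.

Lemma sf_pairingZ a f (c : sfsym E) : sf_pairing (a *: f) c = a * sf_pairing f c.
Proof.
by rewrite /sf_pairing mulr_sumr; apply: eq_bigr => S _; rewrite mcoeffZ mulrA.
Qed.

Lemma sf_pairing_sum I (r : seq I) (P : pred I) F (c : sfsym E) :
  sf_pairing (\sum_(i <- r | P i) F i) c = \sum_(i <- r | P i) sf_pairing (F i) c.
Proof.
rewrite /sf_pairing exchange_big /=; apply: eq_bigr => S _.
by rewrite raddf_sum mulr_suml.
Qed.

Lemma sf_pairingX u (c : sfsym E) :
  sf_pairing 'X_[u] c = if u == sf_mnm (mnm_set u) then c (mnm_set u) else 0.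
Proof.
rewrite /sf_pairing; case: eqP => [uS|uS].
  rewrite (bigD1 (mnm_set u)) //= mcoeffX {1}uS eqxx mul1r big1 ?addr0 // => S SU.
  rewrite mcoeffX; case: eqP => [uS'|]; last by rewrite mul0r.
  by rewrite uS' mnm_set_sf eqxx in SU.
rewrite big1 // => S _; rewrite mcoeffX; case: eqP => [uS'|]; last by rewrite mul0r.
by case: uS; rewrite uS' mnm_set_sf.
Qed.

Lemma sf_pairingXM u B (c : sfsym E) :
  sf_pairing ('X_[u] * 'X_[sf_mnm B]) c =
  if (u == sf_mnm (mnm_set u)) && [disjoint mnm_set u & B]
  then c (mnm_set u :|: B) else 0.
Proof.
rewrite -mpolyXD sf_pairingX.
have -> : mnm_set (u + sf_mnm B)%MM = mnm_set u :|: B.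
  by apply/setP => e; rewrite !inE mnmDE sf_mnmE addn_eq0 negb_and; case: (e \in B).
congr (if _ then _ else _); apply/eqP/andP => [uB|[/eqP uU dis]].
  have uBe e : (u (enum_rank e) + (e \in B) = (e \in mnm_set u :|: B))%N.
    by rewrite -!sf_mnmE -uB mnmDE.
  split.
    apply/eqP/mnm_ext => e; rewrite sf_mnmE; have := uBe e; rewrite !inE.
    by case: (u _) => [|[|n]] //; case: (e \in B).
  rewrite -setI_eq0; apply/eqP/setP => e; have := uBe e; rewrite !inE.
  by case: (u _) => [|[|n]] //; case: (e \in B).
apply: mnm_ext => e; rewrite mnmDE {1}uU !sf_mnmE in_setU.
case: (boolP (e \in mnm_set u)) => // eu.
by rewrite (disjointFr dis eu).
Qed.

(** The pairing of [c] with the product of the monomial on [S] and the generator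
    of the Cordovil ideal attached to [C]. *)
Definition circuit_relation (c : sfsym E) (C : signvec E) S : int :=
  \sum_(k in supp C) sint (C k) *
    (if [disjoint S & supp C :\ k] then c (S :|: supp C :\ k) else 0).

Definition boundary (C : signvec E) : {mpoly int[#|E|]} :=
  \sum_(k in supp C) sint (C k) *: \prod_(j in supp C :\ k) dvar j.

Lemma sf_pairing_boundary u C c :
  sf_pairing ('X_[u] * boundary C) c =
  if u == sf_mnm (mnm_set u) then circuit_relation c C (mnm_set u) else 0.
Proof.
rewrite /boundary mulr_sumr sf_pairing_sum.
transitivity (\sum_(k in supp C) sint (C k) *
    (if (u == sf_mnm (mnm_set u)) && [disjoint mnm_set u & supp C :\ k]
     then c (mnm_set u :|: supp C :\ k) else 0)).
  by apply: eq_bigr => k _; rewrite -scalerAr sf_pairingZ prod_dvar sf_pairingXM.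
by case: eqP => _ //=; rewrite big1 // => k _; rewrite mulr0.
Qed.

(** The ideal is spanned by the products of a monomial with a generator.  The pairing
    kills every monomial divisible by a square, so only [boundary C] times a
    square-free monomial gives a condition.  If this product does not have degree
    [p], the condition concerns coefficients of [c] that are zero anyway. *)
Lemma dual_cordovilP (N : oriented_matroid E) p (c : sfsym E) :
  reflect ((forall S, c S != 0 -> #|S| = p) /\
           forall C, C \in signed_circuits N -> forall S, circuit_relation c C S = 0)
          (c \in dual_cordovil N p).
Proof.
apply: (iffP andP) => -[cp hc].
  have {}cp S : c S != 0 -> #|S| = p by move/(implyP (forallP cp S))/eqP.
  split=> // C CN S; have [dSC|dSC] := eqVneq (#|S| + #|supp C|)%N p.+1.
    have := sf_pairing_boundary (sf_mnm S) C c; rewrite mnm_set_sf eqxx => <-.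
    apply: (asboolP _ hc).
      exists [:: ('X_[sf_mnm S], boundary C)]; rewrite big_seq1; split=> // g.
      by rewrite inE => /eqP ->; right; exists C.
    rewrite mulr_sumr; apply: rpred_sum => k kC.
    rewrite -scalerAr prod_dvar -mpolyXD; apply: rpredZ.
    rewrite dhomogX /= mdegD !mdeg_sf_mnm.
    by rewrite (cardsD1 k (supp C)) kC add1n addnS in dSC; move/eqP: dSC; rewrite eqSS.
  apply: big1 => k kC; case: ifP => [dis|]; last by rewrite mulr0.
  have [->|/cp] := eqVneq (c (S :|: supp C :\ k)) 0; first by rewrite mulr0.
  rewrite cardsU disjoint_setI0 // cards0 subn0 => h; case/eqP: dSC.
  by rewrite (cardsD1 k (supp C)) kC add1n addnS h.
split; first by apply/forallP => S; apply/implyP => /cp ->.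
apply/asboolP => f [s [sG ->]] _; rewrite sf_pairing_sum big_seq big1 // => -[a g] /sG /=.
move=> gG; rewrite [a]mpolyE mulr_suml sf_pairing_sum big1 // => u _.
rewrite -scalerAl sf_pairingZ; apply/eqP; rewrite mulf_eq0; apply/orP; right; apply/eqP.
case: gG => [[e ->]|[C CN ->]]; last first.
  by rewrite (sf_pairing_boundary u C) hc // if_same.
rewrite /dvar mpolyXn -mpolyXD sf_pairingX; case: eqP => //.
move/(congr1 (fun m : 'X_{1..#|E|} => m (enum_rank e))).
rewrite sf_mnmE mnmDE mulmnE mnm1E eqxx mul1n.
by case: (e \in _); rewrite addn2.
Qed.

End SquareFree.

(** * The leading form and the circuit relations *)

Section LeadingForm.
Variable E : finType.
Implicit Types (A B S U : {set E}) (T C : signvec E) (N : oriented_matroid E).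
Implicit Types (a : E -> int) (s : seq E).

(** For [c] vanishing in degrees below [p], this is the functional induced by [c] on
    the [p]-th graded piece, read on square-free monomials.  The formula does not
    mention the oriented matroid, and is therefore compatible with all
    inclusions. *)
Definition leading p (c : chains E) : sfsym E :=
  [ffun S : {set E} => if #|S| == p then moment S c else 0].

Lemma leading_is_zmod_morphism p : zmod_morphism (leading p).
Proof.
move=> c d; apply/ffunP => S; rewrite !ffunE.
by case: eqP => _; rewrite ?raddfB ?subr0.
Qed.
HB.instance Definition _ p :=
  GRing.isZmodMorphism.Build (chains E) (sfsym E) (leading p)
    (leading_is_zmod_morphism p).

(** With [s] the support of a circuit and [a] its indicator of negative, or of
    positive, elements, the shifted product vanishes on every tope. *)
Definition shifted_moment a S s (c : chains E) : int :=
  \sum_T c T * (hmon S T * \prod_(k <- s) (heaviside k T - a k)).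

Lemma shifted_moment_cons a S k s c :
  shifted_moment a S (k :: s) c =
  shifted_moment a (k |: S) s c - a k * shifted_moment a S s c.
Proof.
rewrite /shifted_moment mulr_sumr -sumrB; apply: eq_bigr => T _.
rewrite big_cons setUC -hmonU {3}/hmon big_set1.
set h := heaviside k T; set H := hmon S T; set P := \prod_(_ <- _) _.
by rewrite mulrBl mulrBr mulrBr !mulrA [a k * _]mulrC -!mulrA [a k * (H * P)]mulrCA !mulrA.
Qed.

(** The shifts only contribute terms of degree below that of the product. *)
Lemma shifted_moment_top p a S s c :
  (forall U, (#|U| < p)%N -> moment U c = 0) -> (#|S| + size s <= p)%N ->
  shifted_moment a S s c = moment (S :|: [set x in s]) c.
Proof.
move=> c0; elim: s S => [|k s IHs] S Sp.
  apply: eq_bigr => T _; rewrite big_nil mulr1.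
  by congr (_ * hmon _ _); apply/setP => x; rewrite !inE orbF.
rewrite shifted_moment_cons !IHs; last 2 first.
- by apply: leq_trans Sp; rewrite /= addnS ltnW.
- apply: leq_trans Sp; rewrite /= addnS -addSn leq_add2r.
  by rewrite cardsU1 -add1n leq_add2r leq_b1.
rewrite [X in _ - _ * X]c0 ?mulr0 ?subr0.
  by congr (moment _ c); apply/setP => x; rewrite !inE orbCA orbA.
apply: leq_trans Sp; rewrite /= addnS ltnS; apply: leq_trans (leq_card_setU _ _).1 _.
by rewrite leq_add2l cardsE card_size.
Qed.

(** The terms of the expansion in which two or more shifts are taken have degree
    below [p]. *)
Lemma shifted_moment_expand p a S s c :
  (forall U, (#|U| < p)%N -> moment U c = 0) -> uniq s ->
  (#|S| + size s <= p.+1)%N ->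
  shifted_moment a S s c =
  moment (S :|: [set x in s]) c
  - \sum_(k <- s) a k * moment (S :|: [set x in s] :\ k) c.
Proof.
move=> c0; elim: s S => [|k s IHs] S us Sp.
  rewrite big_nil subr0; apply: eq_bigr => T _; rewrite big_nil mulr1.
  by congr (_ * hmon _ _); apply/setP => x; rewrite !inE orbF.
move: us => /= /andP[ks us].
rewrite shifted_moment_cons IHs //; last first.
  apply: leq_trans Sp; rewrite /= addnS -addSn leq_add2r.
  by rewrite cardsU1 -add1n leq_add2r leq_b1.
rewrite (shifted_moment_top a c0); last by rewrite -ltnS -addnS.
rewrite big_cons opprD addrAC addrA; congr (_ - _ - _).
- by congr (moment _ c); apply/setP => x; rewrite !inE orbCA orbA.
- congr (_ * moment _ c); apply/setP => x; rewrite !inE.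
  by case: eqP => //= ->; rewrite (negPf ks).
- rewrite !big_seq; apply: eq_bigr => j js; congr (_ * moment _ c).
  have kj : k != j by apply: contraNneq ks => ->.
  apply/setP => x; rewrite !inE; have [->|//] := eqVneq x k.
  by rewrite kj orbT.
Qed.

Lemma shifted_moment_circuit N a S C c : c \in tope_chains N ->
  (forall T, T \in topes N -> exists2 k, k \in supp C & heaviside k T = a k) ->
  shifted_moment a S (enum (supp C)) c = 0.
Proof.
move=> /tope_chainsP cN hC; apply: big1 => T _.
have [->|/cN/hC[k kC hk]] := eqVneq (c T) 0; first by rewrite mul0r.
rewrite [\prod_(_ <- _) _](big_rem k) ?mem_enum //=.
by rewrite hk subrr mul0r !mulr0.
Qed.

(** No tope agrees with a signed circuit, nor with its opposite, on the whole
    support; this gives two products of shifted Heaviside functions that vanish on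
    all topes, and the difference of their expansions is the relation. *)
Lemma moment_circuit N p S C c : loopless N -> C \in signed_circuits N ->
  c \in dual_VG N p -> (#|S| + #|supp C| <= p.+1)%N ->
  \sum_(k in supp C) sint (C k) * moment (S :|: supp C :\ k) c = 0.
Proof.
move=> lN CN /dual_VGP[cN c0] SC.
have [CV C0] : C \in vectors N /\ C != sv0 by move: CN; rewrite inE => /and3P[].
have sides T : T \in topes N ->
    (exists e, C e != Zero /\ T e = C e) /\ (exists f, C f != Zero /\ T f = sopp (C f)).
  move=> /(topesP _ lN)[TN T0].
  move: CV; rewrite inE => /forall_inP/(_ T TN)/orthogonalP[zz|//].
  case/eqP: C0; apply/ffunP => e; rewrite ffunE.
  by case: (zz e) => // Te; have := T0 e; rewrite Te.
pose a1 e : int := (C e == Minus)%:R; pose a2 e : int := (C e == Plus)%:R.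
have szC : (#|S| + size (enum (supp C)) <= p.+1)%N by rewrite -cardE.
have z1 : shifted_moment a1 S (enum (supp C)) c = 0.
  apply: shifted_moment_circuit cN _ => T /sides[_ [k [Ck Tk]]].
  by exists k; rewrite ?inE // /heaviside /a1 Tk; move: Ck; case: (C k).
have z2 : shifted_moment a2 S (enum (supp C)) c = 0.
  apply: shifted_moment_circuit cN _ => T /sides[[k [Ck Tk]] _].
  by exists k; rewrite ?inE // /heaviside /a2 Tk.
have := etrans z1 (esym z2).
rewrite !(shifted_moment_expand _ c0) ?enum_uniq // => /addrI/oppr_inj.
rewrite !big_enum /= set_enum => z12.
rewrite -[RHS](subrr (\sum_(k in supp C) a1 k * moment (S :|: supp C :\ k) c)) {1}z12.
rewrite -sumrB; apply: eq_bigr => k _.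
by rewrite -mulrBl; congr (_ * _); rewrite /a1 /a2; case: (C k).
Qed.

(** The relation for [S] and [C] is the pairing of [c] with the relation of the
    previous lemma, except that the terms with [S] meeting the rest of [C] are
    dropped; those are moments of degree below [p]. *)
Lemma leading_cordovil N p c : loopless N -> c \in dual_VG N p ->
  leading p c \in dual_cordovil N p.
Proof.
move=> lN cVG; apply/dual_cordovilP; split=> [S|C CN S].
  by rewrite ffunE; case: (#|S| =P p).
have /dual_VGP[_ c0] := cVG.
have cardk k : k \in supp C -> (#|supp C| = #|supp C :\ k|.+1)%N.
  by move=> kC; rewrite (cardsD1 k (supp C)) kC add1n.
have [dSC|dSC] := eqVneq (#|S| + #|supp C|)%N p.+1; last first.
  apply: big1 => k kC; case: ifP => [dis|]; last by rewrite mulr0.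
  rewrite ffunE cardsU disjoint_setI0 // cards0 subn0.
  case: eqP => [h|]; last by rewrite mulr0.
  by case/eqP: dSC; rewrite (cardk k) // addnS h.
apply: etrans (moment_circuit lN CN cVG (eq_leq dSC)); apply: eq_bigr => k kC.
have {}dSC : (#|S| + #|supp C :\ k| = p)%N.
  by move: dSC; rewrite (cardk k) // addnS => -[].
congr (_ * _); case: ifP => dis; rewrite ?ffunE.
  by rewrite cardsU disjoint_setI0 // cards0 subn0 dSC eqxx.
have I0 : (0 < #|S :&: (supp C :\ k)|)%N by rewrite card_gt0 setI_eq0 dis.
rewrite c0 // cardsU dSC ltn_subrL I0 -dSC addn_gt0.
by rewrite (leq_trans I0) // subset_leq_card ?subsetIl.
Qed.

Lemma leading_eq0 N p c : c \in dual_VG N p ->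
  (leading p c == 0) = (c \in dual_VG N p.+1).
Proof.
move=> /dual_VGP[cN c0]; apply/eqP/dual_VGP => [/ffunP l0|[_ c1]].
  split=> // U; rewrite ltnS leq_eqVlt => /orP[Up|/c0 //].
  by have := l0 U; rewrite !ffunE Up.
by apply/ffunP => S; rewrite !ffunE; case: eqP => // Sp; apply: c1; rewrite Sp.
Qed.

Lemma dual_VG_sub N N' p q : {subset topes N <= topes N'} -> (q <= p)%N ->
  {subset dual_VG N p <= dual_VG N' q}.
Proof.
move=> NN' qp c /dual_VGP[/tope_chainsP cN c0]; apply/dual_VGP; split.
  by apply/tope_chainsP => T /cN/NN'.
by move=> U Uq; apply: c0; apply: leq_trans Uq qp.
Qed.

End LeadingForm.

(** * Dual chains of sets without broken circuits *)

Section DualChains.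
Variables (E : finType) (N : oriented_matroid E).
Implicit Types (A S U : {set E}) (T C : signvec E) (e f s : E).

Definition place e : nat := enum_rank e.

Lemma place_inj : injective place.
Proof. by move=> e f /ord_inj/enum_rank_inj. Qed.

Definition weight S : nat := \sum_(e in S) place e.

Definition above S e : {set E} := [set t in S | (place e < place t)%N].

(** Equivalently, [S] contains no broken circuit for the order of [place]: a circuit
    through [e] in [e |: above S e] has [e] as its first element.  The case of [e]
    in [S] expresses that [S] is independent. *)
Definition nbc S : bool := [forall e, ~~ in_closure N (above S e) e].

(** The fibres of [leader S] are the blocks on which the signs of a tope will be
    reversed independently. *)
Definition leader S e : E :=
  nth e (enum E) (find (fun f => generic N (above S f) e != Zero) (enum E)).

Definition base_tope S : signvec E := [ffun e => generic N (above S (leader S e)) e].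

Definition flipped S A : signvec E :=
  [ffun e => if leader S e \in A then sopp (base_tope S e) else base_tope S e].

(** An alternating sum over a cube of topes, one direction for each element of [S].
    Its leading form is the product over [s] in [S] of the sums of the variables
    in the block of [s], with the signs of [base_tope S]. *)
Definition dual_chain S : chains E :=
  [ffun T => \sum_(A in powerset S) (-1) ^+ #|A| * (flipped S A == T)%:R].

Lemma moment_dual_chain S U :
  moment U (dual_chain S) =
  \sum_(A in powerset S) (-1) ^+ #|A| * hmon U (flipped S A).
Proof.
transitivity (\sum_T \sum_(A in powerset S)
                (-1) ^+ #|A| * (flipped S A == T)%:R * hmon U T).
  by apply: eq_bigr => T _; rewrite ffunE mulr_suml.
rewrite exchange_big /=; apply: eq_bigr => A _.
rewrite (bigD1 (flipped S A)) //= eqxx mulr1 big1 ?addr0 // => T TA.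
by rewrite eq_sym (negPf TA) mulr0 mul0r.
Qed.

(** If no element of [U] is in the block of [s], flipping that block does not
    change the monomial on [U], and the terms cancel in pairs. *)
Lemma moment_dual_chain_cover S U :
  moment U (dual_chain S) != 0 -> S \subset leader S @: U.
Proof.
apply: contraNT => /subsetPn[s sS sU].
pose t A := if s \in A then A :\ s else s |: A.
have tK : involutive t.
  move=> A; rewrite /t; case: (boolP (s \in A)) => sA; first by rewrite setD11 setD1K.
  by rewrite setU11 setU1K.
have tS A : (t A \in powerset S) = (A \in powerset S).
  rewrite !powersetE /t; case: ifP => sA.
    apply/idP/idP => [h|]; last exact/subset_trans/subD1set.
    by rewrite -(setD1K sA) subUset sub1set sS.
  by rewrite subUset sub1set sS.
rewrite moment_dual_chain; set x := \sum_(A in _) _.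
suff /eqP : x = - x by rewrite -subr_eq0 opprK -mulr2n mulrn_eq0.
rewrite {1}/x (reindex_inj (inv_inj tK)) -sumrN; apply: eq_big => [A|A _]; first exact: tS.
rewrite -mulNr; congr (_ * _).
  rewrite /t; case: ifPn => sA; last by rewrite cardsU1 sA exprS mulN1r.
  by rewrite [in RHS](cardsD1 s) sA exprS mulN1r opprK.
apply: eq_bigr => e eU; rewrite /heaviside !ffunE.
suff -> : (leader S e \in t A) = (leader S e \in A) by [].
have ls : leader S e != s by apply: contraNneq sU => <-; apply: imset_f.
by rewrite /t; case: ifP; rewrite !inE (negPf ls).
Qed.

Section NoBrokenCircuit.
Variable S : {set E}.
Hypothesis nbcS : nbc S.

Lemma leader_found e :
  has (fun f => generic N (above S f) e != Zero) (enum E).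
Proof.
by apply/hasP; exists e; rewrite ?mem_enum // generic_eq0 (forallP nbcS).
Qed.

Lemma leader_neq0 e : generic N (above S (leader S e)) e != Zero.
Proof. exact: (nth_find e (leader_found e)). Qed.

(** The covector attached to [e] itself does not vanish at [e]. *)
Lemma place_leader e : (place (leader S e) <= place e)%N.
Proof.
rewrite /leader; set p := fun f => _; have pfound := leader_found e.
have le : (find p (enum E) <= place e)%N.
  rewrite leqNgt; apply/negP => /(before_find e).
  by rewrite nth_enum_rank /p generic_eq0 (forallP nbcS).
have lt : (find p (enum E) < #|E|)%N by rewrite cardE -has_find.
have := enum_val_nth e (Ordinal lt); rewrite /= => <-.
by rewrite /place enum_valK.
Qed.

Lemma leader_id s : s \in S -> leader S s = s.
Proof.
move=> sS; apply/place_inj/eqP; rewrite eqn_leq place_leader leqNgt.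
apply: contra (leader_neq0 s) => lt.
by rewrite generic_vanishes // inE sS.
Qed.

Lemma base_tope_neq0 e : base_tope S e != Zero.
Proof. by rewrite ffunE leader_neq0. Qed.

(** The composition, in the order of [place], of the covectors attached to the
    elements of [E], with the signs prescribed by [A]: at [e] the leader of [e]
    decides. *)
Lemma flipped_covector A : flipped S A \in covectors N.
Proof.
pose V f := if f \in A then svopp (generic N (above S f)) else generic N (above S f).
have VN : all (mem (covectors N)) [seq V f | f <- enum E].
  apply/allP => _ /mapP[f _ ->]; rewrite /V; case: ifP => _; last exact: generic_covector.
  exact/(covN (covectorsP N))/generic_covector.
have := compose_list_covector (covectorsP N) VN.
suff -> : compose_list [seq V f | f <- enum E] = flipped S A by [].
apply/ffunP => e; rewrite compose_listE find_map.
have -> : find (preim V (fun X => X e != Zero)) (enum E) =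
          find (fun f => generic N (above S f) e != Zero) (enum E).
  by apply: eq_find => f /=; rewrite /V; case: ifP => _; rewrite ?ffunE ?sopp_eq0.
rewrite (nth_map e) -?has_find ?leader_found // -/(leader S e).
by rewrite [RHS]ffunE [base_tope S e]ffunE /V; case: ifP => _ //; rewrite ffunE.
Qed.

Lemma dual_chain_topes : loopless N -> dual_chain S \in tope_chains N.
Proof.
move=> lN; apply/tope_chainsP => T; apply: contraNT => TN.
rewrite ffunE big1 // => A _; case: eqP => [AT|_]; last exact: mulr0.
case/negP: TN; rewrite -AT; apply/(topesP _ lN); split=> [|e].
  exact: flipped_covector.
by rewrite ffunE; case: ifP => _; rewrite ?sopp_eq0 base_tope_neq0.
Qed.

Lemma dual_chain_VG : loopless N -> dual_chain S \in dual_VG N #|S|.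
Proof.
move=> lN; apply/dual_VGP; split=> [|U US]; first exact: dual_chain_topes.
apply: contraTeq US => /moment_dual_chain_cover/subset_leq_card SU.
by rewrite -leqNgt (leq_trans SU) // leq_imset_card.
Qed.

(** Only the choice of signs that makes the tope positive on [S] contributes. *)
Lemma moment_dual_chain_diag :
  moment S (dual_chain S) * moment S (dual_chain S) = 1.
Proof.
pose A0 := [set s in S | base_tope S s == Minus].
have A0S : A0 \in powerset S by rewrite powersetE; apply/subsetP => s /setIdP[].
suff -> : moment S (dual_chain S) = (-1) ^+ #|A0| by rewrite -exprMn mulrNN mulr1 expr1n.
rewrite moment_dual_chain (bigD1 A0) //= [X in _ * X]big1 ?mulr1; last first.
  move=> s sS; rewrite /heaviside ffunE leader_id // inE sS /=.
  by have := base_tope_neq0 s; case: (base_tope S s).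
rewrite big1 ?addr0 // => A /andP[]; rewrite powersetE => AS AA0.
have [s sS sA] : exists2 s, s \in S & (s \in A) != (base_tope S s == Minus).
  case: (boolP [exists s in S, (s \in A) != (base_tope S s == Minus)]).
    by case/exists_inP => s; exists s.
  move=> /exists_inPn h; case/eqP: AA0; apply/setP => s; rewrite inE.
  have [/h|sS] := boolP (s \in S); first by rewrite negbK => /eqP.
  by apply: contraNF sS; apply: (subsetP AS).
rewrite /hmon (bigD1 s) //= /heaviside ffunE leader_id //.
have := base_tope_neq0 s; move: sA.
by case: (s \in A); case: (base_tope S s); rewrite ?mul0r ?mulr0.
Qed.

(** A set of the size of [S] with nonzero moment has one element in each block, and
    each is placed at or after the element of [S] in its block. *)
Lemma moment_dual_chain_triangular U : #|U| = #|S| ->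
  moment U (dual_chain S) != 0 -> U != S -> (weight S < weight U)%N.
Proof.
move=> US /moment_dual_chain_cover cov UneS.
have im : leader S @: U = S.
  by apply/esym/eqP; rewrite eqEcard cov -US leq_imset_card.
have inj : {in U &, injective (leader S)}.
  by apply/imset_injP; rewrite im US.
have -> : weight S = (\sum_(e in U) place (leader S e))%N.
  by rewrite /weight -{1}im big_imset.
rewrite ltn_neqAle leq_sum ?andbT => [|e _]; last exact: place_leader.
apply: contra UneS => /eqP eqW; rewrite -im; apply/eqP.
rewrite -[LHS]imset_id; apply: eq_in_imset => e eU; apply/esym/place_inj.
apply/eqP; rewrite eqn_leq place_leader /= leqNgt; apply/negP => lt.
have : (\sum_(f in U) place (leader S f) < weight U)%N.
  rewrite /weight (bigD1 e) // [X in (_ < X)%N](bigD1 e) //= -addSn leq_add //.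
  by apply: leq_sum => f _; apply: place_leader.
by rewrite eqW ltnn.
Qed.

End NoBrokenCircuit.

(** Straightening: the relation of a circuit [C] with first element [k], applied to
    a set [S] containing the rest of [C], expresses the coefficient of [S]
    through sets in which [k] replaces a later element. *)
Lemma straightening p (c : sfsym E) S : c \in dual_cordovil N p ->
  (forall U, (weight U < weight S)%N -> c U = 0) -> ~~ nbc S -> c S = 0.
Proof.
move=> /dual_cordovilP[_ rel] low /forallPn[k]; rewrite negbK => clk.
have kS : k \notin above S k by rewrite inE ltnn andbF.
have [C CN [kC Ck]] := circuit_of_closure clk kS.
have CS j : j \in supp C :\ k -> j \in S /\ (place k < place j)%N.
  rewrite !inE => /andP[jk jC]; have := subsetP Ck j; rewrite !inE (negPf jk) => /(_ jC).
  by move/andP.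
have restS : S :\: (supp C :\ k) :|: supp C :\ k = S.
  apply/setP => j; rewrite in_setU in_setD.
  by have := CS j; case: (j \in supp C :\ k) => [[]|] //; rewrite orbF.
have := rel C CN (S :\: (supp C :\ k)).
rewrite /circuit_relation (bigD1 k) //= restS big1 => [|j /andP[jC jk]].
  have -> : [disjoint S :\: (supp C :\ k) & supp C :\ k].
    by rewrite disjoint_sym disjoints_subset; apply/subsetP => i ik; rewrite inE in_setD ik.
  rewrite addr0 => /eqP.
  by rewrite mulf_eq0 sint_eq0; move: kC; rewrite inE => /negPf -> /= /eqP.
case: ifP => [dis|]; last by rewrite mulr0.
have jCk : j \in supp C :\ k by rewrite !inE jk; move: jC; rewrite inE.
have [jS kj] := CS j jCk.
set W := _ :|: _; rewrite low ?mulr0 //.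
have kSD : k \notin S.
  have kCj : k \in supp C :\ j by rewrite !inE eq_sym jk; move: kC; rewrite inE.
  apply/negP => kS'; have := disjointFl dis kCj.
  by rewrite !inE eqxx kS'.
(* Exchanging the later element j of S for k lowers the weight. *)
have WE : j |: W = k |: S.
  rewrite -[in RHS]restS; apply/setP => i; rewrite !inE.
  have [->|ij] := eqVneq i j; first by rewrite jk; move: jC; rewrite inE => ->; rewrite !orbT.
  have [->|ik] := eqVneq i k; first by move: kC; rewrite inE => ->; rewrite !orbT.
  by [].
have jW : j \notin W by rewrite !inE eqxx jk orbF; move: jC; rewrite inE => ->.
have : weight (j |: W) = weight (k |: S) by rewrite WE.
rewrite /weight !big_setU1 //= => h.
by rewrite -(ltn_add2l (place j)) h ltn_add2r.
Qed.

(** Induction on a lower bound for the weights at which [c] is nonzero: at the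
    smallest such weight only sets without broken circuits occur, and their dual
    chains correct [c]. *)
Lemma leading_surjective p (c : sfsym E) : loopless N -> c \in dual_cordovil N p ->
  exists2 g, g \in dual_VG N p & leading p g = c.
Proof.
move=> lN; pose w := (weight [set: E]).+1.
have wmax U : (weight U < w)%N.
  rewrite ltnS /weight [X in (X <= _)%N]big_mkcond [X in (_ <= X)%N]big_mkcond.
  by apply: leq_sum => e _; rewrite inE; case: ifP.
suff ind n : forall d : sfsym E, d \in dual_cordovil N p ->
    (forall U, d U != 0 -> (w <= weight U + n)%N) ->
    exists2 g, g \in dual_VG N p & leading p g = d.
  by move=> cA; apply: (ind w c cA) => U _; rewrite leq_addl.
elim: n => [|n IHn] d dA dlow.
  exists 0; first exact: rpred0.
  rewrite raddf0; apply/ffunP => U; rewrite ffunE; apply/esym/eqP.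
  by apply: contraTT (wmax U) => /dlow; rewrite addn0 -leqNgt.
have /dual_cordovilP[dp _] := dA.
pose P S := (d S != 0) && (weight S + n < w)%N.
have PW S : P S -> (weight S + n.+1 = w)%N.
  by case/andP => /dlow h; rewrite -addnS => h'; apply/eqP; rewrite eqn_leq h h'.
have Pnbc S : P S -> nbc S.
  move=> PS; have /andP[dS _] := PS; apply: contraNT dS => nS; apply/eqP.
  apply: straightening dA _ nS => U US; apply/eqP; apply: contraTT US => /dlow.
  by rewrite -(PW S PS) leq_add2r -leqNgt.
have Pp S : P S -> #|S| = p by case/andP => /dp.
pose g := \sum_(S | P S) dual_chain S *~ (d S * moment S (dual_chain S)).
have gVG : g \in dual_VG N p.
  apply: rpred_sum => S PS; apply: rpredMz.
  by rewrite -(Pp S PS) dual_chain_VG // Pnbc.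
have lg U : #|U| = p -> leading p g U =
    \sum_(S | P S) moment U (dual_chain S) * (d S * moment S (dual_chain S)).
  move=> Up; rewrite ffunE Up eqxx raddf_sum; apply: eq_bigr => S _.
  by rewrite /= raddfMz mulrzz.
have [||g' g'VG g'd] := IHn (d - leading p g).
- by rewrite rpredB // leading_cordovil.
- move=> U; rewrite !ffunE leqNgt; apply: contra => Un.
  have [Up|Up] := eqVneq #|U| p; last first.
    rewrite subr0; apply: contraNT Up => /dp ->.
    by [].
  have -> : moment U g = leading p g U by rewrite ffunE Up eqxx.
  rewrite lg //.
  have off S : P S -> S != U -> moment U (dual_chain S) = 0.
    move=> PS SU; apply: contraTeq Un => mU; rewrite -leqNgt.
    rewrite -(PW S PS) addnS -addSn leq_add2r.
    by apply: (moment_dual_chain_triangular (Pnbc S PS) _ mU); rewrite ?(Pp S PS) // eq_sym.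
  case: (boolP (P U)) => PU.
    rewrite (bigD1 U) //= big1 => [|S /andP[PS SU]]; last by rewrite off ?mul0r.
    by rewrite addr0 mulrCA moment_dual_chain_diag ?Pnbc // mulr1 subrr.
  rewrite big1 => [|S PS]; last by rewrite off ?mul0r //; apply: contraNneq PU => <-.
  by move: PU; rewrite /P Un andbT negbK subr0.
exists (g' + g); first exact: rpredD.
by rewrite raddfD /= g'd subrK.
Qed.

End DualChains.

(** * The exact sequence of cosheaves *)

Section LeadingMap.
Variables (E : finType) (N : oriented_matroid E) (p : nat).
Hypothesis N_loopless : loopless N.

Definition leading_stalk (c : sub_of (dual_VG N p)) : sub_of (dual_cordovil N p) :=
  SubOf (leading_cordovil N_loopless (sub_valP c)).

Lemma leading_stalk_is_zmod_morphism : zmod_morphism leading_stalk.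
Proof. by move=> c d; apply: val_inj; rewrite /= raddfB. Qed.
HB.instance Definition _ :=
  GRing.isZmodMorphism.Build (sub_of (dual_VG N p)) (sub_of (dual_cordovil N p))
    leading_stalk leading_stalk_is_zmod_morphism.

End LeadingMap.

Lemma subcosheaf_of_subset (I : Type) (le : I -> I -> Prop) (V : zmodType)
    (S T : I -> zmodClosed V) (hS : has_inclusions le S) (hT : has_inclusions le T) :
  (forall s, {subset S s <= T s}) -> subcosheaf hS hT.
Proof.
move=> ST.
have nat t s (h : le t s) (x : sub_of (S s)) :
    inclusion (ST t) (comap (inclusion_cosheaf hS) h x) =
    comap (inclusion_cosheaf hT) h (inclusion (ST s) x).
  exact: val_inj.
by exists (@CosheafHom I le (inclusion_cosheaf hS) (inclusion_cosheaf hT)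
             (fun s => inclusion (ST s)) nat).
Qed.

Theorem theorem3 (R : realType) (E : finType) (d : nat) (M : oriented_matroid E)
    (M_loopless : loopless M) (M_rank : omrank M = d) :
  exists (hS : has_inclusions (@cone_sub R E M) (@sign_stalk E M))
         (hP : forall p : nat, has_inclusions (@cone_sub R E M) (@VG_stalk E M p))
         (hA : forall p : nat, has_inclusions (@cone_sub R E M) (@cordovil_stalk E M p)),
    [/\ (forall p : nat, (1 <= p)%N -> (p < d)%N -> subcosheaf (hP p.+1) (hP p)),
        ((1 <= d)%N -> subcosheaf (hP 1%N) hS)
      & forall p : nat,
          exists (i : cosheaf_hom (inclusion_cosheaf (hP p.+1)) (inclusion_cosheaf (hP p)))
                 (q : cosheaf_hom (inclusion_cosheaf (hP p)) (inclusion_cosheaf (hA p))),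
            is_inclusion i /\ short_exact i q].
Proof.
have topes_sub (F' F : flag M) : cone_sub R F' F ->
    {subset topes (initial_matroid F) <= topes (initial_matroid F')}.
  by move/cone_sub_flag; apply: initial_topes_mono.
have lM (F : flag M) := initial_loopless M_loopless F.
have hS : has_inclusions (@cone_sub R E M) (@sign_stalk E M).
  move=> F' F /topes_sub sub c /tope_chainsP cF.
  by apply/tope_chainsP => T /cF/sub.
have hP p : has_inclusions (@cone_sub R E M) (@VG_stalk E M p).
  by move=> F' F /topes_sub sub; apply: dual_VG_sub.
(* An element of the smaller Cordovil stalk is a leading form on that stalk, and
   the leading form of the same chain lies in the larger one. *)
have hA p : has_inclusions (@cone_sub R E M) (@cordovil_stalk E M p).
  move=> F' F sub c /(leading_surjective (lM F))[g gF <-].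
  exact/(leading_cordovil (lM F'))/(hP p _ _ sub).
have P_sub p F : {subset VG_stalk p.+1 F <= @VG_stalk E M p F}.
  exact: dual_VG_sub.
exists hS, hP, hA; split=> [p _ _|_|p].
- exact/subcosheaf_of_subset/P_sub.
- by apply: subcosheaf_of_subset => F c /dual_VGP[].
have [i i_incl] : subcosheaf (hP p.+1) (hP p) by apply/subcosheaf_of_subset/P_sub.
have q_nat F' F (h : cone_sub R F' F) (x : sub_of (VG_stalk p F)) :
    leading_stalk (lM F') (comap (inclusion_cosheaf (hP p)) h x) =
    comap (inclusion_cosheaf (hA p)) h (leading_stalk (lM F) x).
  exact: val_inj.
exists i, (@CosheafHom _ _ (inclusion_cosheaf (hP p)) (inclusion_cosheaf (hA p))
             (fun F => leading_stalk (p := p) (lM F)) q_nat).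
split=> // F; split=> [x y ixy|y|z].
- by apply: val_inj; rewrite /= -!i_incl ixy.
- split=> [/(congr1 val)/= /eqP|[x <-]].
    rewrite (leading_eq0 (sub_valP y)) => yP.
    by exists (SubOf yP); apply: val_inj; rewrite /= i_incl.
  apply: val_inj => /=; apply/eqP; rewrite (leading_eq0 (sub_valP _)) i_incl.
  exact: sub_valP.
- have [g gP gz] := leading_surjective (lM F) (sub_valP z).
  by exists (SubOf gP); apply: val_inj.
Qed.
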